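(* Let $(\mathcal{Y},T,\nu)$, $(\mathcal{X},S)$, $\ell:\mathcal{X}\times\mathcal{Y}\to\mathbb{R}$, $\Theta$ and $\varphi:\mathcal{X}\to\Theta$ satisfy the standard assumptions, and let $$\Theta_{\min}=\operatorname*{argmin}_{\theta\in\Theta}L(S_\theta:\nu).$$ Then $\Theta_{\min}$ is non-empty and compact. Moreover, if $(\theta_n)_{n\ge1}$ is an optimal $\varphi$-estimation scheme, then $\hat\theta_n=\theta_n(y,Ty,\dots,T^{n-1}y)$ converges to $\Theta_{\min}$ for $\nu$-almost every $y\in\mathcal{Y}$. Conversely, for every $\theta_0\in\Theta_{\min}$ there exists an optimal $\varphi$-estimation scheme that converges to $\theta_0$ for $\nu$-almost every $y \in \mathcal{Y}$.
   Context: Standard assumptions: (i) $\mathcal{Y}$ is a non-empty Polish space, $T:\mathcal{Y}\to\mathcal{Y}$ is Borel measurable, and $\nu$ is a Borel probability measure on $\mathcal{Y}$ that is invariant and ergodic under $T$; (ii) $\mathcal{X}$ is a non-empty compact metric space and $S:\mathcal{X}\to\mathcal{X}$ is continuous; (iii) $\ell:\mathcal{X}\times\mathcal{Y}\to\mathbb{R}$ is lower semicontinuous and there is $\ell^*\in L^1(\nu)$ with $\sup_{x\in\mathcal{X}}|\ell(x,y)|\le \ell^*(y)$ for all $y\in\mathcal{Y}$; (iv) $\Theta$ is a compact metrizable space and $\varphi:\mathcal{X}\to\Theta$ is continuous with $\varphi\circ S=\varphi$. For $\theta\in\Theta$ let $\mathcal{X}_\theta=\varphi^{-1}\{\theta\}$,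 a compact $S$-invariant set, and let $S_\theta:\mathcal{X}_\theta\to\mathcal{X}_\theta$ be the restriction of $S$. $\mathcal{J}(S_\theta:\nu)$ is the set of Borel probability measures $\lambda$ on $\mathcal{X}_\theta\times\mathcal{Y}$ that are invariant under $S_\theta\times T:(x,y)\mapsto(S_\theta x,Ty)$ and have $\mathcal{Y}$-marginal $\nu$, and $L(S_\theta:\nu)=\inf_{\lambda\in\mathcal{J}(S_\theta:\nu)}\int\ell\,d\lambda$, with the convention $\inf\emptyset=+\infty$ (relevant only if $\mathcal{X}_\theta=\emptyset$). Optimal $\varphi$-estimation scheme: a sequence of measurable functions $\theta_n:\mathcal{Y}^n\to\Theta$, $n\ge1$, such that $\theta_n=\varphi\circ x_n$, where the functions $x_n:\mathcal{Y}^n\to\mathcal{X}$ are such that for $\nu$-almost every $y\in\mathcal{Y}$, with $\hat x_n=x_n(y,Ty,\dots,T^{n-1}y)$, $$\lim_{n}\frac1n\sum_{k=0}^{n-1}\ell(S^k\hat x_n,T^ky)=\lim_n\inf_{x\in\mathcal{X}}\frac1n\sum_{k=0}^{n-1}\ell(S^kx,T^ky).$$ The scheme converges to a point or set in the sense of the values $\hat\theta_n=\theta_n(y,\dots,T^{n-1}y)$; a sequence converges to a set $\Theta_0$ if the distance (in a metric compatible with the topology of $\Theta$) from its $n$-th term to $\Theta_0$ tends to $0$. *)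

(* Defs.v *)
From HB Require Import structures.
From mathcomp Require Import all_boot all_order all_algebra.
From mathcomp Require Import all_classical all_reals all_analysis.

Set Implicit Arguments.
Unset Strict Implicit.
Unset Printing Implicit Defensive.

Import Order.TTheory GRing.Theory Num.Theory.
Import numFieldNormedType.Exports.

Local Open Scope classical_set_scope.
Local Open Scope ring_scope.

(* A measurableType is pointed, so a "non-empty space" is one with a point. *)
#[short(type="pmetricType")]
HB.structure Definition PointedMetric (K : numDomainType) :=
  {M of Metric K M & Pointed M}.

(* The underlying topological space is Polish when it is moreover separable
   (see below); the metric is any complete compatible one. *)
#[short(type="completePMetricType")]
HB.structure Definition CompletePointedMetric (K : numDomainType) :=
  {M of Metric K M & Complete M & Pointed M}.

Definition separable (T : topologicalType) : Prop :=
  exists2 D : set T, countable D & dense D.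

Notation borel T := (g_sigma_algebraType (@open T)).

Definition invariant_measure (R : realType) d (E : measurableType d)
    (f : E -> E) (mu : probability E R) : Prop :=
  forall A : set E, measurable A -> mu (f @^-1` A) = mu A.

Definition ergodic (R : realType) d (E : measurableType d)
    (f : E -> E) (mu : probability E R) : Prop :=
  forall A : set E, measurable A -> f @^-1` A = A ->
    mu A = 0%E \/ mu A = 1%E.

(* The set J(S : nu). *)
Definition joinings (R : realType) (Z Y : ptopologicalType)
    (S : Z -> Z) (T : Y -> Y) (nu : probability (borel Y) R) :
    set (probability (borel (Z * Y)%type) R) :=
  [set lambda |
    invariant_measure
      ((fun p => (S p.1, T p.2)) : borel (Z * Y)%type -> borel (Z * Y)%type)
      lambda /\
    forall B : set (borel Y), measurable B ->
      lambda ((snd : borel (Z * Y)%type -> borel Y) @^-1` B) = nu B].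

(* Z with the distinguished point z. *)
Definition pointed_at (Z : topologicalType) (z : Z) : Type := Z.
HB.instance Definition _ (Z : topologicalType) (z : Z) :=
  Topological.on (pointed_at z).
HB.instance Definition _ (Z : topologicalType) (z : Z) :=
  isPointed.Build (pointed_at z) z.

Section fibers.
Context (R : realType) (X Theta : topologicalType) (Y : ptopologicalType).
Variables (S : X -> X) (T : Y -> Y) (phi : X -> Theta).
Hypothesis phiS : phi \o S =1 phi.

(* As a type, carries the subspace topology of X. *)
Definition fiber (theta : Theta) : set X := phi @^-1` [set theta].

Lemma fiber_stable theta (x : fiber theta) : S (val x) \in fiber theta.
Proof.
by case: x => x /= /set_mem <-; apply/mem_set; exact: phiS.
Qed.

Definition fiber_map theta (x : fiber theta) : fiber theta :=
  SigSub (fiber_stable x).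

(* L(S_theta : nu).  The point z only serves to make the fiber a pointedType:
   neither the Borel sets nor the set of joinings depend on it, and an empty
   fiber yields the infimum of the empty set, that is +oo. *)
Definition Lval (l : X * Y -> R) (nu : probability (borel Y) R)
    (theta : Theta) : \bar R :=
  ereal_inf [set v | exists (z : fiber theta)
    (lambda : probability (borel (pointed_at z * Y)%type) R),
    joinings (@fiber_map theta : pointed_at z -> pointed_at z) T nu lambda /\
    v = (\int[lambda]_p (l (set_val (p.1 : fiber theta), p.2))%:E)%E].

Definition Theta_min (l : X * Y -> R) (nu : probability (borel Y) R) :
    set Theta :=
  [set theta | forall theta', (Lval l nu theta <= Lval l nu theta')%E].

End fibers.

(* Sequences indexed by n >= 1 are indexed here by n : nat through n.+1. *)

Definition orbit_tuple (Y : Type) (T : Y -> Y) (n : nat) (y : Y) :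
    n.+1.-tuple Y :=
  [tuple iter k T y | k < n.+1].

Definition avg_loss (R : realType) (X Y : Type) (S : X -> X) (T : Y -> Y)
    (l : X * Y -> R) (n : nat) (x : X) (y : Y) : R :=
  n.+1%:R^-1 * \sum_(0 <= k < n.+1) l (iter k S x, iter k T y).

Definition optimal_scheme (R : realType) (X : Type) (Y Theta : ptopologicalType)
    (S : X -> X) (T : Y -> Y) (nu : probability (borel Y) R)
    (l : X * Y -> R) (phi : X -> Theta)
    (th : forall n, n.+1.-tuple Y -> Theta) : Prop :=
  (forall n, measurable_fun [set: n.+1.-tuple (borel Y)]
     (th n : n.+1.-tuple (borel Y) -> borel Theta)) /\
  exists x : forall n, n.+1.-tuple Y -> X,
    (forall n, th n = phi \o x n) /\
    {ae nu, forall y,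
      let u := fun n => avg_loss S T l n (x n (orbit_tuple T n y)) y in
      let v := fun n => inf [set avg_loss S T l n x' y | x' in [set: X]] in
      [/\ cvgn u, cvgn v & limn u = limn v]}.

Definition dist_to_set (R : realType) (M : metricType R) (x : M) (A : set M) :
    R :=
  inf [set mdist x a | a in A].

(* Main.v *)
From HB Require Import structures.
From mathcomp Require Import finmap.
Require Import Defs.
From mathcomp Require Import all_boot all_order all_algebra.
From mathcomp Require Import all_classical all_reals all_analysis.
From mathcomp Require Import measurable_realfun lra.

Set Implicit Arguments.
Unset Strict Implicit.
Unset Printing Implicit Defensive.

Import Order.TTheory GRing.Theory Num.Theory.
Import numFieldNormedType.Exports.

Local Open Scope classical_set_scope.
Local Open Scope ring_scope.

(** For x in X and y in Y let A_n(x, y) be the average of l over the first n+1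
    points of the orbit of (x, y) under S x T, and let L(theta) be the infimum of
    the integrals of l over the joinings of the fiber over theta with nu.  The
    theorem follows from two almost sure comparisons between A_n and L.

    - Detection [ae_Lval_le].  For almost every y the following holds for all
      theta and a: if there are arbitrarily long orbit segments, started at
      points x with phi x arbitrarily close to theta, such that A_n(x, y) is
      at most a up to arbitrarily small errors, then L(theta) <= a.  The null
      set does not depend on theta, on a, or on how the points x are chosen, so
      the points may be chosen as functions of the data.
    - Approximation [ae_fiber_upper].  If L(theta) < c then for almost every y
      and every e > 0, for all large n, some x in the fiber over theta has
      A_n(x, y) <= c + e.

    The rest is compactness of Theta.  Approximation followed by detection shows
    that L is lower semicontinuous [Lval_lsc], so that its minimum m is attained
    on a compact set, and that the infimum of A_n(., y) over X tends to m almost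
    surely [inf_avg_cvg].  If the parameters of asymptotically optimal points
    stayed away from Theta_min along a subsequence, they would have a cluster
    point outside Theta_min, where detection gives L <= m.  For theta0 in
    Theta_min, approximation says that almost optimal points of the fiber over
    theta0 are asymptotically optimal in X.

    Detection is a construction of joinings.  The frequencies of visits of the
    given orbit segments, taken along an ultrafilter, form a finitely additive
    invariant probability m on all subsets of X x Y; by Birkhoff's theorem
    m(X x A) = nu(A) for all A in a countable algebra, if y is generic.  As T is
    only measurable, weak limits are of no direct use.  Instead X is written as
    a continuous image of the Cantor space, where m, restricted to the algebra of
    the products of a cylinder by a set of the countable algebra, is countably
    additive: compactness disposes of the first factor and nu of the second
    [cylinder_decreasing_to0].  The extended measure lambda, pushed to X x Y,
    satisfies lambda(E) <= m(E) for countable unions E of rectangles with an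
    open first side and a second side in the algebra [joining_measure].  This
    one-sided inequality implies that lambda is invariant [joining_invariant],
    that it sits over theta, and that it integrates l to at most a
    [limit_joining].

    Approximation is proved by contradiction.  The y for which the sums of l - c
    over all orbits starting in the fiber are unbounded above form a set that
    contains its preimage under T, hence has measure 0 or 1; measure 1 would
    contradict the maximal ergodic inequality for a joining with integral below
    c [ergodic_upper].  The same lemma, applied to nu itself, is the part of
    Birkhoff's theorem used above. *)

(** * Measures and null sets *)

Lemma ae_forall_countable d (T : measurableType d) (R : realType)
    (mu : {measure set T -> \bar R}) (I : countType) (P : I -> T -> Prop) :
  (forall i, {ae mu, forall x, P i x}) -> {ae mu, forall x, forall i, P i x}.
Proof.
move=> h; pose F n := if @choice.unpickle I n is Some i then ~` [set x | P i x] else set0.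
have : mu.-negligible (\bigcup_n F n).
  apply: negligible_bigcup => n; rewrite /F; case: choice.unpickle => [i|].
    exact: h.
  exact: negligible_set0.
apply: negligibleS => x /= /existsNP[i nP].
by exists (choice.pickle i) => //; rewrite /F choice.pickleK.
Qed.

Lemma ae_imply d (T : measurableType d) (R : realType)
    (mu : {measure set T -> \bar R}) (P Q : T -> Prop) :
  (forall x, P x -> Q x) -> {ae mu, forall x, P x} -> {ae mu, forall x, Q x}.
Proof. by move=> PQ; apply: filterS. Qed.

Lemma ae_and d (T : measurableType d) (R : realType)
    (mu : {measure set T -> \bar R}) (P Q : T -> Prop) :
  {ae mu, forall x, P x} -> {ae mu, forall x, Q x} -> {ae mu, forall x, P x /\ Q x}.
Proof. by move=> hP hQ; apply: filterS2 hP hQ. Qed.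

Lemma ae_exists d (T : measurableType d) (R : realType) (mu : probability T R)
    (P : T -> Prop) : {ae mu, forall x, P x} -> exists x, P x.
Proof.
move=> aeP; apply: contrapT => /forallNP nP.
have /(measure_negligible measurableT) : mu.-negligible setT.
  by apply: negligibleS aeP => x _; exact: nP.
by move=> mu0; have := probability_setT mu; rewrite mu0 => /eqP; rewrite eqe eq_sym oner_eq0.
Qed.

Lemma finite_measure_unique d (R : realType) (T : measurableType d)
    (G : set (set T)) (m1 m2 : {measure set T -> \bar R}) :
  setI_closed G -> G setT -> G `<=` measurable -> (m1 setT < +oo)%E ->
  (forall A, G A -> m1 A = m2 A) -> forall A, <<s G >> A -> m1 A = m2 A.
Proof.
move=> GI GT Gm fin m12.
apply: (g_sigma_algebra_measure_unique G Gm (fun=> setT)) => //.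
by apply/seteqP; split => // t _; exists 0%N.
Qed.

Lemma pushforward_probability d1 d2 (T1 : measurableType d1)
    (T2 : measurableType d2) (R : realType) (P : probability T1 R) (f : T1 -> T2) :
  measurable_fun setT f ->
  exists Q : probability T2 R, forall A, Q A = P (f @^-1` A).
Proof.
move=> mf; pose fm : {mfun T1 >-> T2} := HB.pack f (isMeasurableFun.Build _ _ _ _ _ mf).
by exists (distribution P fm).
Qed.

Lemma generated_measurable d (E : measurableType d) (Z : pointedType)
    (G : set (set Z)) (f : E -> g_sigma_algebraType G) :
  (forall A : set Z, G A -> measurable (f @^-1` A)) -> measurable_fun setT f.
Proof.
move=> hf; apply: (@measurability _ _ _ (g_sigma_algebraType G) setT f G erefl).
by move=> _ [A oA <-]; rewrite setTI; exact: hf.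
Qed.

Lemma harmonic_lt (R : realType) (e : R) : 0 < e ->
  exists k : nat, forall i, (k <= i)%N -> i.+1%:R^-1 < e.
Proof.
move=> e0; exists (Num.truncn e^-1) => i ki.
rewrite invf_plt ?posrE//; apply: lt_le_trans (truncnS_gt _) _.
by rewrite ler_nat ltnS.
Qed.

Section factor.
Context (R : realType) d (E : measurableType d) (mu : probability E R).
Context d' (Y : measurableType d') (nu : probability Y R) (pi : E -> Y).
Hypothesis mpi : measurable_fun setT pi.
Hypothesis pimu : forall B, measurable B -> mu (pi @^-1` B) = nu B.

Lemma integrable_factor (g : Y -> \bar R) :
  nu.-integrable setT g -> mu.-integrable setT (g \o pi).
Proof.
move=> /integrableP[mg ig]; apply/integrableP; split.
  exact: (measurableT_comp mg mpi).
have := @ge0_integral_pushforward _ _ _ _ R pi mpi mu setT (fun x => `|g x|%E).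
rewrite preimage_setT => <- //; last exact: measurableT_comp.
by rewrite (@eq_measure_integral _ _ _ _ nu)// => A mA _; exact: pimu.
Qed.

Lemma integral_factor (g : Y -> \bar R) : measurable_fun setT g ->
  mu.-integrable setT (g \o pi) -> (\int[mu]_e g (pi e) = \int[nu]_e g e)%E.
Proof.
move=> mg ig; have := integral_pushforward mpi mg (D := setT) ig measurableT.
rewrite preimage_setT => <-.
by rewrite (@eq_measure_integral _ _ _ _ nu)// => A mA _; exact: pimu.
Qed.

End factor.

(** * The maximal ergodic inequality and upper ergodic bounds *)

Section measure_preserving.
Context (R : realType) d (E : measurableType d) (mu : probability E R).
Variable (f : E -> E).
Hypothesis mf : measurable_fun setT f.
Hypothesis finv : invariant_measure f mu.

Definition birkhoff_sum (T : Type) (f : T -> T) (g : T -> R) (n : nat) (e : T) : R :=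
  \sum_(0 <= k < n) g (iter k f e).

Lemma birkhoff_sumS (T : Type) (h : T -> T) (g : T -> R) n e :
  birkhoff_sum h g n.+1 e = g e + birkhoff_sum h g n (h e).
Proof.
rewrite /birkhoff_sum big_nat_recl//=; congr (_ + _).
by apply: eq_big_nat => k _; rewrite -iterSr.
Qed.

Lemma integrable_invariant (g : E -> \bar R) :
  mu.-integrable setT g -> mu.-integrable setT (g \o f).
Proof. by move=> ig; apply: integrable_factor ig. Qed.

Lemma integral_invariant (g : E -> \bar R) : mu.-integrable setT g ->
  (\int[mu]_e g (f e) = \int[mu]_e g e)%E.
Proof.
move=> ig; apply: (integral_factor mf finv); first exact: measurable_int ig.
exact: integrable_invariant.
Qed.

Variable g : E -> R.
Hypothesis ig : mu.-integrable setT (EFin \o g).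

(** The maximum of the Birkhoff sums of order at most n, the empty one included.
    The recursion shows at once that g = max_sum n.+1 - max_sum n \o f wherever
    max_sum n.+1 is positive. *)
Fixpoint max_sum (n : nat) (e : E) : R :=
  if n is m.+1 then Num.max 0 (g e + max_sum m (f e)) else 0.

Lemma max_sum_ge0 n e : 0 <= max_sum n e.
Proof. by case: n => //= n; rewrite le_max lexx. Qed.

Lemma max_sumS n e : max_sum n e <= max_sum n.+1 e.
Proof.
elim: n e => [|n IH] e; first by rewrite max_sum_ge0.
by rewrite [leLHS]/= [leRHS]/= ge_max !le_max lexx/= lerD2l IH orbT.
Qed.

Lemma max_sum_mono n m e : (n <= m)%N -> max_sum n e <= max_sum m e.
Proof.
move=> nm; rewrite -(subnK nm); elim: (m - n)%N => // k IH.
by rewrite addSn (le_trans IH)// max_sumS.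
Qed.

Lemma birkhoff_le_max_sum n e : birkhoff_sum f g n e <= max_sum n e.
Proof.
elim: n e => [|n IH] e; first by rewrite /birkhoff_sum big_nil.
by rewrite birkhoff_sumS [leRHS]/= le_max lerD2l IH orbT.
Qed.

Lemma max_sum_integrable n : mu.-integrable setT (EFin \o max_sum n).
Proof.
elim: n => [|n IH].
  by rewrite (_ : EFin \o _ = cst 0%E)//; exact: integrable0.
have h : mu.-integrable setT (EFin \o (fun e => g e + max_sum n (f e))).
  rewrite (_ : EFin \o _ = (EFin \o g) \+ ((EFin \o max_sum n) \o f))%E//.
  by apply: integrableD => //; exact: (integrable_invariant IH).
apply: le_integrable (h) => //.
  apply/measurable_EFinP; apply: measurable_maxr => //.
  exact/measurable_EFinP/(measurable_int _ h).
move=> e _; rewrite lee_fin [max_sum _ _]/= ger0_norm ?le_max ?lexx//.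
by rewrite ge_max normr_ge0 ler_norm.
Qed.

(** Garsia's argument: g is at least max_sum n - max_sum n \o f where max_sum n is
    positive, and this difference is at most 0 elsewhere.  As its integral
    vanishes by invariance, g has a nonnegative integral over the set where
    max_sum n is positive, and these sets exhaust the space up to a null set. *)
Lemma maximal_ergodic :
  {ae mu, forall e, exists n, 0 < birkhoff_sum f g n e} ->
  (0 <= \int[mu]_e (g e)%:E)%E.
Proof.
move=> hpos.
have mmax n : measurable_fun setT (max_sum n).
  by apply/measurable_EFinP; exact: (measurable_int _ (max_sum_integrable n)).
pose P n := [set e | 0 < max_sum n e].
have mP n : measurable (P n).
  rewrite (_ : P n = max_sum n @^-1` `]0, +oo[%classic).
    by rewrite -[X in measurable X]setTI; exact: mmax.
  by rewrite preimage_itvoy.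
pose G n e := (g e * \1_(P n) e)%:E.
have mG n : measurable_fun setT (G n).
  apply/measurable_EFinP; apply: measurable_funM => //.
  by apply/measurable_EFinP; exact: measurable_int ig.
have dom := @dominated_convergence _ _ _ mu setT measurableT G (EFin \o g)
  (fun e => `|g e|%:E) mG (measurable_int _ ig).
have {dom} [] := dom.
- apply: filterS hpos => e [n npos] _.
  apply: cvg_near_cst; exists n => // m /= nm.
  rewrite /G indicE mem_set ?mulr1//.
  apply: lt_le_trans npos _; rewrite (le_trans (birkhoff_le_max_sum _ _))//.
  exact: max_sum_mono.
- exact: integrable_norm.
- apply: aeW => e n _; rewrite /G indicE; case: (_ \in _) => /=.
    by rewrite mulr1.
  by rewrite mulr0 normr0 lee_fin.
move=> _ _ cG; rewrite -(cvg_lim _ cG)//; apply: lime_ge.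
  by apply/cvg_ex; eexists; exact: cG.
apply: nearW => n /=.
have iG : mu.-integrable setT (G n).
  apply: le_integrable (ig) => // e _; rewrite /G/= lee_fin indicE normrM.
  by case: (_ \in _); rewrite /= ?normr1 ?mulr1// normr0 mulr0.
have iM := max_sum_integrable n.
have iMf := integrable_invariant iM.
have -> : 0%E = (\int[mu]_e ((max_sum n e)%:E - (max_sum n (f e))%:E))%E.
  rewrite integralB//; have /= -> := integral_invariant iM; rewrite subee//.
  exact: integrable_fin_num.
apply: le_integral => //; first exact: integrableB.
move=> e _; rewrite /G -EFinB lee_fin indicE.
have [Pe|nPe] := boolP (e \in P n); last first.
  have -> : max_sum n e = 0.
    apply/eqP; rewrite eq_le max_sum_ge0 andbT leNgt; apply/negP => h.
    by move: nPe; rewrite mem_set.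
  by rewrite mulr0 sub0r oppr_le0 max_sum_ge0.
rewrite mulr1; move: Pe; rewrite inE /P/=.
case: n {P mP G mG cG iG iM iMf} => [|n]; first by rewrite ltxx.
move=> Pe; have := max_sumS n (f e); move: Pe.
rewrite [max_sum n.+1 e]/=; set a := g e + _.
rewrite lt_max ltxx/= => a0; rewrite (max_idPr (ltW a0)) /a => h; lra.
Qed.

End measure_preserving.

Section ergodic_upper.
Context (R : realType) dY (Y : measurableType dY) (nu : probability Y R).
Variable T : Y -> Y.
Hypothesis mT : measurable_fun setT T.
Hypothesis Tinv : invariant_measure T nu.
Hypothesis Terg : ergodic T nu.

(** The iterated preimages of B decrease and all have the measure of B, so their
    intersection is an invariant set with that measure. *)
Lemma ergodic_subinvariant (B : set Y) : measurable B -> T @^-1` B `<=` B ->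
  nu B = 0%E \/ nu B = 1%E.
Proof.
move=> mB TB.
pose F n := iter n (fun A => T @^-1` A) B.
have mF n : measurable (F n).
  elim: n => //= n IH; rewrite -[X in measurable X]setTI; exact: mT.
have FS n : F n.+1 `<=` F n.
  by elim: n => [|n IH]//= e; exact: IH.
have nuF n : nu (F n) = nu B.
  by elim: n => //= n <-; exact: Tinv.
have Finv : T @^-1` (\bigcap_n F n) = \bigcap_n F n.
  apply/seteqP; split => e h n _; last exact: (h n.+1).
  by apply: FS; exact: (h n).
have nuI : nu (\bigcap_n F n) = nu B.
  have := nonincreasing_cvg_mu (mu := nu) (F := F) _ mF.
  rewrite ltey_eq fin_num_measure// => /(_ isT) h.
  have /h{}h : measurable (\bigcap_n F n) by exact: bigcapT_measurable.
  have : nonincreasing_seq F.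
    apply/nonincreasing_seqP => n; apply/subsetPset; exact: FS.
  move=> /h /cvg_lim <-//.
  rewrite (_ : nu \o F = cst (nu B)) ?lim_cst//.
  by apply/funext => n /=; rewrite nuF.
rewrite -nuI; apply: Terg => //; exact: bigcapT_measurable.
Qed.

Context dE (E : measurableType dE) (mu : probability E R) (f : E -> E) (pi : E -> Y).
Hypothesis mf : measurable_fun setT f.
Hypothesis finv : invariant_measure f mu.
Hypothesis mpi : measurable_fun setT pi.
Hypothesis pimu : forall B, measurable B -> mu (pi @^-1` B) = nu B.
Variable (g : E -> R) (c : R).
Hypothesis ig : mu.-integrable setT (EFin \o g).
Hypothesis gc : (\int[mu]_e (g e)%:E < c%:E)%E.
Variables (P : nat -> R -> set Y) (h : Y -> R).
Hypothesis mP : forall n t, measurable (P n t).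
Hypothesis Pmono : forall n t t' y, t' <= t -> P n t y -> P n t' y.
Hypothesis PS : forall n t y, P n t (T y) -> P n.+1 (t - h y) y.
Hypothesis Pg : forall n t e, P n t (pi e) -> t < birkhoff_sum f g n e.

(** P n t stands for the set of the y such that the n-th Birkhoff sum of g exceeds
    t at every point above y.  The y that belong, for every M, to P n (n c + M) for
    some n form a set that contains its preimage: going from T y to y costs at
    most c + h y, which is absorbed by M.  Full measure of this set would make
    some sum of g - c positive at almost every point of E. *)
Lemma ergodic_upper :
  {ae nu, forall y, exists M : nat, forall n, ~ P n (n%:R * c + M%:R) y}.
Proof.
pose B := \bigcap_M \bigcup_n P n (n%:R * c + M%:R).
have mB : measurable B.
  by apply: bigcapT_measurable => M; exact: bigcupT_measurable.
have TB : T @^-1` B `<=` B.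
  move=> y By M _.
  have [n _ Pn] := By (Num.truncn `|M%:R + h y + c|).+1 I.
  exists n.+1 => //; apply: Pmono (PS Pn).
  rewrite -natr1 mulrDl mul1r.
  have := real_truncnS_gt (num_real `|M%:R + h y + c|).
  have := ler_norm (M%:R + h y + c).
  by set u := `|_|; set v := _%:R; lra.
have [B0|B1] := ergodic_subinvariant mB TB.
  exists B; split => // y /=; apply: contra_notP => nBy.
  have /existsNP[M hM] : ~ (forall M, (\bigcup_n P n (n%:R * c + M%:R)) y).
    by move=> h'; apply: nBy => M _; exact: h'.
  by exists M => n Pn; apply: hM; exists n.
exfalso.
have ic : mu.-integrable setT (EFin \o (cst c : E -> R)).
  by apply: finite_measure_integrable_cst.
have igc : mu.-integrable setT (EFin \o (fun e => g e - c)).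
  rewrite (_ : EFin \o _ = (EFin \o g) \- (EFin \o (cst c : E -> R)))%E//.
  exact: integrableB.
have := maximal_ergodic mf finv igc.
have -> : (\int[mu]_e (g e - c)%:E = \int[mu]_e (g e)%:E - c%:E)%E.
  under eq_integral do rewrite EFinB.
  rewrite integralB//; congr (_ - _)%E.
  have := integral_cst mu measurableT c%:E.
  by move=> /= ->; rewrite -[RHS]mule1; congr (_ * _)%E; exact: probability_setT.
rewrite sube_ge0 ?fin_numE// => H.
suff : (c%:E <= \int[mu]_e (g e)%:E)%E by rewrite leNgt gc.
apply: H; exists (~` (pi @^-1` B)); split.
- apply: measurableC; rewrite -[X in measurable X]setTI; exact: mpi.
- rewrite preimage_setC pimu; last exact: measurableC.
  by rewrite probability_setC// B1 subee.
- move=> e /=; apply: contra_not => Be.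
  have [n _ /Pg Hn] := Be 0%N I; exists n.
  have -> : birkhoff_sum f (fun e => g e - c) n e = birkhoff_sum f g n e - n%:R * c.
    by rewrite /birkhoff_sum sumrB big_const_nat subn0 iter_addr_0 mulr_natl.
  by rewrite subr_gt0; move: Hn; rewrite addr0.
Qed.

End ergodic_upper.

(** The case of [ergodic_upper] where E is Y itself. *)
Lemma birkhoff_upper (R : realType) d (Y : measurableType d)
    (nu : probability Y R) (T : Y -> Y) (g : Y -> R) (c : R) :
  measurable_fun setT T -> invariant_measure T nu -> ergodic T nu ->
  nu.-integrable setT (EFin \o g) -> (\int[nu]_y (g y)%:E < c%:E)%E ->
  {ae nu, forall y, exists M : nat, forall n,
     birkhoff_sum T g n y <= n%:R * c + M%:R}.
Proof.
move=> mT Tinv Terg ig gc.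
have mg : measurable_fun setT g by apply/measurable_EFinP; exact: measurable_int ig.
pose P n t := [set y | t < birkhoff_sum T g n y].
have miter k : measurable_fun setT (iter k T).
  elim: k => [|k IH]; first exact: measurable_id.
  exact: (measurableT_comp mT).
have msum n : measurable_fun setT (birkhoff_sum T g n).
  by apply: measurable_sum => k; exact: (measurableT_comp mg).
have := @ergodic_upper _ _ _ nu T mT Tinv Terg _ _ nu T id mT Tinv
  (@measurable_id _ _ _) (fun _ _ => erefl) g c ig gc P (fun y => - g y).
have mP n t : measurable (P n t).
  rewrite /P -preimage_itvoy -[X in measurable X]setTI; exact: msum.
move=> /(_ mP)[]//.
- by move=> n t t' y tt' /(le_lt_trans tt').
- by move=> n t y; rewrite /P/= birkhoff_sumS opprK addrC ltrD2l.
move=> N [mN N0 sub]; exists N; split => //; apply: subset_trans sub => y /=.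
apply: contra_not => -[M HM]; exists M => n; rewrite leNgt; apply/negP; exact: HM.
Qed.

Lemma indic01 (R : realType) (Z : Type) (E : set Z) p : 0 <= (\1_E p : R) <= 1.
Proof. by rewrite indicE; case: (_ \in _); rewrite ?lexx ?ler01. Qed.

Section averages.
Context (R : realType) (Z : Type) (tau : Z -> Z).
Implicit Types (g h : Z -> R).

Definition average g n z : R := n.+1%:R^-1 * birkhoff_sum tau g n.+1 z.

Lemma averageD g h n z :
  average (fun p => g p + h p) n z = average g n z + average h n z.
Proof. by rewrite /average /birkhoff_sum big_split/= mulrDr. Qed.

Lemma averageZ a g n z : average (fun p => a * g p) n z = a * average g n z.
Proof. by rewrite /average /birkhoff_sum -mulr_sumr mulrCA. Qed.

Lemma average_le g h n z : (forall p, g p <= h p) -> average g n z <= average h n z.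
Proof.
move=> gh; rewrite /average ler_pM2l ?invr_gt0//.
by apply: ler_sum => k _.
Qed.

Lemma average_cst a n z : average (fun=> a) n z = a.
Proof.
rewrite /average /birkhoff_sum big_const_nat subn0 iter_addr_0.
by rewrite -(mulr_natl a) mulKf ?pnatr_eq0.
Qed.

Lemma average_sum (I : Type) (s : seq I) (g : I -> Z -> R) n z :
  average (fun p => \sum_(k <- s) g k p) n z = \sum_(k <- s) average (g k) n z.
Proof.
elim: s => [|k s IH].
  rewrite big_nil -[RHS](average_cst 0 n z); congr average.
  by apply/funext => p; rewrite big_nil.
rewrite big_cons -IH -averageD; congr average.
by apply/funext => p; rewrite big_cons.
Qed.

(** The two sums differ only by their first and last terms. *)
Lemma average_shift g n z : (forall p, 0 <= g p <= 1) ->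
  `|average (g \o tau) n z - average g n z| <= n.+1%:R^-1.
Proof.
move=> g01; rewrite /average -mulrBr normrM ger0_norm ?invr_ge0//.
rewrite -[leRHS]mulr1 ler_pM2l ?invr_gt0//.
have -> : birkhoff_sum tau (g \o tau) n.+1 z =
    birkhoff_sum tau g n.+1 z - g z + g (iter n.+1 tau z).
  rewrite [in RHS]birkhoff_sumS (addrC (g z)) addrK.
  rewrite {1}/birkhoff_sum big_nat_recr//=; congr (_ + _).
  by apply: eq_big_nat => k _ /=; rewrite -iterS iterSr.
have := g01 z; have := g01 (iter n.+1 tau z).
move=> /andP[a1 a2] /andP[b1 b2]; rewrite ler_norml; apply/andP; split; lra.
Qed.

End averages.

Lemma birkhoff_limsup (R : realType) d (Y : measurableType d)
    (nu : probability Y R) (T : Y -> Y) (g : Y -> R) :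
  measurable_fun setT T -> invariant_measure T nu -> ergodic T nu ->
  nu.-integrable setT (EFin \o g) ->
  {ae nu, forall y, forall e, 0 < e ->
    \forall n \near \oo, average T g n y <= fine (\int[nu]_y (g y)%:E) + e}.
Proof.
move=> mT Tinv Terg ig.
set I := fine _.
have IE : (\int[nu]_y (g y)%:E = I%:E)%E.
  by rewrite fineK//; exact: integrable_fin_num.
have h (k : nat) : {ae nu, forall y, exists M : nat, forall n,
    birkhoff_sum T g n y <= n%:R * (I + k.+1%:R^-1) + M%:R}.
  by apply: birkhoff_upper => //; rewrite IE lte_fin ltrDl invr_gt0.
apply: filterS (ae_forall_countable h) => y hy e e0.
pose k := Num.truncn (2 / e).
have ke : k.+1%:R^-1 < e / 2.
  by rewrite invf_plt ?posrE ?divr_gt0// invf_div; exact: truncnS_gt.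
have [M hM] := hy k.
exists (Num.truncn (M%:R * (2 / e))) => // n /= nM.
rewrite /average mulrC ler_pdivrMr//.
apply: (le_trans (hM _)).
have : M%:R * (2 / e) <= n.+1%:R.
  by apply: (le_trans (ltW (truncnS_gt _))); rewrite ler_nat ltnS.
rewrite mulrA ler_pdivrMr// => h1.
have : n.+1%:R * k.+1%:R^-1 <= n.+1%:R * (e / 2) by rewrite ler_pM2l// ltW.
set a : R := n.+1%:R in h1 *; set b := k.+1%:R^-1 in ke *.
rewrite mulrDr (mulrC (I + e)) mulrDr => h2; lra.
Qed.

(** * Countable unions of open rectangles *)

Definition countable_base (Y : topologicalType) (U : nat -> set Y) :=
  (forall j, open (U j)) /\
  forall y V, nbhs y V -> exists j, U j y /\ U j `<=` V.

Lemma separable_base (R : realType) (Y : pmetricType R) :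
  separable Y -> exists U : nat -> set Y, countable_base U.
Proof.
move=> [D /pfcard_geP[D0|/unsquash f] dD].
  have := dD setT; rewrite D0 setI0 => /(_ _ openT)[|y []//].
  by exists point.
pose B (p : nat * nat) := (ball (f p.1 : Y) (p.2.+1%:R^-1 : R))^°.
exists (fun n => if choice.unpickle n is Some p then B p else set0); split.
  move=> j; case: choice.unpickle => [p|]; [exact: open_interior|exact: open0].
move=> y V /nbhs_ballP[e /= e0 yV].
pose m := Num.truncn (2 / e); have mgt : m.+1%:R^-1 < e / 2.
  rewrite invf_plt ?posrE ?divr_gt0// invf_div.
  exact: truncnS_gt.
pose r : R := m.+1%:R^-1; have r0 : 0 < r / 2 by rewrite divr_gt0// invr_gt0 ltr0n.
have [|z [/interior_subset yz Dz]] := dD (ball y (r / 2))^° _ (open_interior _).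
  by exists y; exact: nbhsx_ballx.
have [n _ fn] := 'surj_f Dz.
exists (choice.pickle (n, m)); rewrite choice.pickleK /B/= fn; split.
  apply/nbhs_ballP; exists (r / 2) => //= w yw.
  by have := ball_triangle (ball_sym yz) yw; rewrite -splitr.
move=> w /interior_subset zw; apply: yV.
by apply: (le_ball _ (ball_triangle yz zw)); rewrite -/r in mgt *; lra.
Qed.

Section rect_unions.
Variables (X : topologicalType) (Y : Type).

(** These sets take the place of the open sets of X x Y: since W can be stable
    under preimage by a merely measurable T, the class they form is stable under
    preimage by S x T. *)
Definition rect_union (W : set (set Y)) (E : set (X * Y)) : Prop :=
  exists (I : countType) (G : I -> set X) (B : I -> set Y),
    [/\ forall i, open (G i), forall i, W (B i) &
        E = [set p | exists i, G i p.1 /\ B i p.2]].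

Implicit Types (W : set (set Y)) (E F : set (X * Y)).

Lemma sub_rect_union W W' E : W `<=` W' -> rect_union W E -> rect_union W' E.
Proof.
move=> WW' [I [G [B [oO WB ->]]]]; exists I, G, B; split => // i.
exact: WW'.
Qed.

Lemma rect_union_rect W G B : open G -> W B -> rect_union W (G `*` B).
Proof.
move=> oO WB; exists unit, (fun=> G), (fun=> B); split => //.
by apply/seteqP; split => p; [exists tt|case].
Qed.

Lemma rect_unionI W E F : setI_closed W -> rect_union W E -> rect_union W F -> rect_union W (E `&` F).
Proof.
move=> WI [I [G [B [oO WB ->]]]] [J [G' [B' [oG' WB' ->]]]].
exists (I * J)%type, (fun k => G k.1 `&` G' k.2), (fun k => B k.1 `&` B' k.2).
split; [by move=> k; exact: openI|by move=> k; exact: WI|].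
apply/seteqP; split => p /=.
  by move=> [[i []] ? ? [j [] ? ?]]; exists (i, j).
by move=> [[i j] [[? ?] [? ?]]]; split; [exists i|exists j].
Qed.

Lemma rect_union_bigcup W (K : countType) (E : K -> set (X * Y)) :
  (forall k, rect_union W (E k)) -> rect_union W (\bigcup_k E k).
Proof.
move=> h.
pose I k := projT1 (cid (h k)).
pose hO k := cid (projT2 (cid (h k))).
pose G k : I k -> set X := projT1 (hO k).
pose hB k := cid (projT2 (hO k)).
pose B k : I k -> set Y := projT1 (hB k).
have P k : [/\ forall i, open (@G k i), forall i, W (@B k i) &
        E k = [set p | exists i, @G k i p.1 /\ @B k i p.2]].
  exact: (projT2 (hB k)).
exists {k : K & I k}, (fun s => G _ (tagged s)), (fun s => B _ (tagged s)).
split; [by move=> [k i]; case: (P k)|by move=> [k i]; case: (P k)|].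
apply/seteqP; split => p /=.
  move=> [k _]; have [_ _ ->] := P k => -[i [Oi Bi]].
  by exists (existT _ k i).
move=> [[k i] [/= Oi Bi]]; exists k => //; have [_ _ ->] := P k.
by exists i.
Qed.

End rect_unions.

Lemma rect_union_preimage (X X' : topologicalType) (Y Y' : Type) (W : set (set Y))
    (W' : set (set Y')) (S : X' -> X) (T : Y' -> Y) E : continuous S ->
  (forall B, W B -> W' (T @^-1` B)) ->
  rect_union W E -> rect_union W' [set p | E (S p.1, T p.2)].
Proof.
move=> cS WT [I [G [B [oO WB ->]]]].
exists I, (fun i => S @^-1` G i), (fun i => T @^-1` B i); split => // i.
- by apply: open_comp => // ? _; exact: cS.
- exact: WT.
Qed.

(** E is the union over j of V_j x U j, where V_j is the largest open set with
    V_j x U j contained in E. *)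
Lemma rect_union_open (X Y : topologicalType) (W : set (set Y)) (U : nat -> set Y)
    (E : set (X * Y)) :
  countable_base U -> (forall j, W (U j)) -> open E -> rect_union W E.
Proof.
move=> [oU bU] WU; rewrite openE => oE.
exists nat, (fun j => \bigcup_(V in [set V | open V /\ V `*` U j `<=` E]) V), U.
split => //; first by move=> j; apply: bigcup_open => G [].
apply/seteqP; split => [[x y] /oE|[x y] [j [[G [_ GU] Gx] Uy]]]; last first.
  exact: GU.
move=> [[P Q] /= [Px Qy] PQ].
have [j [Ujy UjQ]] := bU _ _ Qy; exists j; split => //=.
exists P^° => //; split; first exact: open_interior.
by move=> [a b] [/= /interior_subset Pa /UjQ Qb]; exact: PQ.
Qed.

Section rect_union_measurable.
Variables (X Y : ptopologicalType).

Lemma continuous_borel (X' : ptopologicalType) (S : X -> X') :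
  continuous S -> measurable_fun setT (S : borel X -> borel X').
Proof.
move=> cS; apply: generated_measurable => A oA; apply: sub_sigma_algebra.
by apply: open_comp => // x _; exact: cS.
Qed.

Lemma borel_measurable_fst : measurable_fun setT (fst : borel (X * Y)%type -> borel X).
Proof.
apply: generated_measurable => A oA; apply: sub_sigma_algebra.
by apply: open_comp => // p _; exact: cvg_fst.
Qed.

Lemma borel_measurable_snd : measurable_fun setT (snd : borel (X * Y)%type -> borel Y).
Proof.
apply: generated_measurable => A oA; apply: sub_sigma_algebra.
by apply: open_comp => // p _; exact: cvg_snd.
Qed.

Lemma measurable_rectangle (G : set (borel X)) (A : set (borel Y)) :
  measurable G -> measurable A -> measurable (G `*` A : set (borel (X * Y)%type)).
Proof.
move=> mG mA.
rewrite (_ : G `*` A = (fst @^-1` G) `&` (snd @^-1` A)) //.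
apply: measurableI; rewrite -[X in measurable X]setTI.
  exact: borel_measurable_fst.
exact: borel_measurable_snd.
Qed.

Lemma rect_union_measurable (E : set (X * Y)) :
  rect_union (@measurable _ (borel Y)) E -> measurable (E : set (borel (X * Y)%type)).
Proof.
move=> [I [G [B [oG mB ->]]]].
rewrite [X in measurable X](_ : _ = \bigcup_i (G i `*` B i)); last first.
  by apply/seteqP; split => p [i]; [exists i|move=> _; exists i].
apply: countable_bigcupT_measurable => [|i]; first exact: countableP.
by apply: measurable_rectangle => //; exact: sub_sigma_algebra.
Qed.

Lemma measurable_prod_map (X' Y' : ptopologicalType) (U : nat -> set Y')
    (S : X -> X') (T : Y -> Y') : countable_base U ->
  measurable_fun setT (S : borel X -> borel X') ->
  measurable_fun setT (T : borel Y -> borel Y') ->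
  measurable_fun setT ((fun p => (S p.1, T p.2)) :
    borel (X * Y)%type -> borel (X' * Y')%type).
Proof.
move=> bU mS mT; apply: generated_measurable => A oA.
have [I [G [B [oG mB ->]]]] : rect_union (@measurable _ (borel Y')) A.
  by apply: rect_union_open (bU) _ oA => j; apply: sub_sigma_algebra; exact: bU.1.
rewrite [X in measurable X](_ : _ = \bigcup_i ((S @^-1` G i) `*` (T @^-1` B i))).
  apply: countable_bigcupT_measurable => [|i]; first exact: countableP.
  apply: measurable_rectangle; rewrite -[X in measurable X]setTI.
    by apply: mS => //; exact: sub_sigma_algebra.
  exact: mT.
by apply/seteqP; split => p [i]; [exists i|move=> _; exists i].
Qed.

End rect_union_measurable.

(** If K x {y} is covered by rectangles then finitely many of them suffice, and
    the finite families whose first sides cover K are countably many. *)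
Lemma measurable_forall_compact (X : ptopologicalType) d (Y : measurableType d)
  (K : set X) (E : set (X * Y)) : compact K -> rect_union measurable E ->
  measurable [set y | forall x, K x -> E (x, y)].
Proof.
move=> cK [I [G [B [oO mB ->]]]].
pose FK := [set F : {fset I} | K `<=` cover [set` F] G].
rewrite [X in measurable X](_ : _ =
    \bigcup_(F in FK) \bigcap_(i in [set` F]) B i); last first.
  apply/seteqP; split => y /=.
    move=> Ky; have : K `<=` cover [set i | B i y] G.
      by move=> x /Ky[i [? ?]]; exists i.
    move: cK; rewrite compact_cover => /[apply] -[//|F FB KF].
    by exists F => // i /= /FB; rewrite inE.
  by move=> [F KF BF] x /KF[i Fi Oi]; exists i; split => //; exact: BF.
rewrite bigcup_mkcond; apply: countable_bigcupT_measurable.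
  exact: countableP.
move=> F; case: ifP => // _; apply: fin_bigcap_measurable => //.
Qed.

Section rect_lsc.
Variables (R : realType) (X : topologicalType) (Y : Type).
Implicit Types (W : set (set Y)) (f g : X * Y -> R).

Definition rect_lsc W f := forall t : R, rect_union W [set p | t < f p].

Lemma rect_lscD W f g : setI_closed W -> rect_lsc W f -> rect_lsc W g ->
  rect_lsc W (fun p => f p + g p).
Proof.
move=> WI hf hg t.
rewrite (_ : [set p | _] = \bigcup_(q : rat)
    ([set p | ratr q < f p] `&` [set p | t - ratr q < g p])).
  by apply: rect_union_bigcup => q; apply: rect_unionI.
apply/seteqP; split => p /=; last by move=> [q _ [/= h1 h2]]; lra.
rewrite -ltrBlDr => /rat_in_itvoo[q]; rewrite in_itv/= => /andP[h1 h2].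
by exists q => //; split => //=; lra.
Qed.

Lemma rect_lsc_birkhoff W (S : X -> X) (T : Y -> Y) f n : setI_closed W ->
  W setT -> continuous S -> (forall B, W B -> W (T @^-1` B)) -> rect_lsc W f ->
  rect_lsc W (birkhoff_sum (fun p => (S p.1, T p.2)) f n).
Proof.
move=> WI WT cS hT hf; elim: n => [|n IH] t.
  rewrite (_ : [set p | _] = (if t < 0 then setT else set0) `*` setT).
    by apply: rect_union_rect => //; case: ifP => _; [exact: openT|exact: open0].
  rewrite /birkhoff_sum; apply/seteqP; split => p /=; rewrite big_nil.
    by move=> ->.
  by case: ifP => // _ [].
rewrite (_ : birkhoff_sum _ _ _ =
   fun p => f p + birkhoff_sum (fun p => (S p.1, T p.2)) f n (S p.1, T p.2)).
  by apply: rect_lscD => // s; exact: rect_union_preimage (IH s).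
by apply/funext => p; rewrite birkhoff_sumS.
Qed.

End rect_lsc.

(** * Finitely coded sets and cylinders over the Cantor space *)

Lemma compact_nested (T : topologicalType) (K : nat -> set T) :
  compact [set: T] -> (forall n, closed (K n)) -> (forall n, K n !=set0) ->
  (forall n, K n.+1 `<=` K n) -> exists t, forall n, K n t.
Proof.
move=> cT clK K0 KS.
have [t ht] := choice K0.
have Kmono n m : (n <= m)%N -> K m `<=` K n.
  move=> nm; rewrite -(subnK nm); elim: (m - n)%N => // k IH x.
  by rewrite addSn => /KS; exact: IH.
have [p [_ clp]] := cT (t @ \oo) _ filterT.
exists p => n; apply: (clK n) => B pB.
have : (t @ \oo) (K n) by exists n => // m /= nm; apply: Kmono (ht m).
move=> tK; exact: clp tK pB.
Qed.

(** Two points of the Cantor space with the same coordinates before N lie in the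
    same cylinder of order N. *)
Definition agree (N : nat) (c c' : cantor_space) :=
  forall i, (i < N)%N -> c i = c' i.

Lemma agree_sym N c c' : agree N c c' -> agree N c' c.
Proof. by move=> h i /h. Qed.

Lemma agree_leq N M c c' : (N <= M)%N -> agree M c c' -> agree N c c'.
Proof. by move=> NM h i iN; apply: h; exact: leq_trans NM. Qed.

Lemma open_agree N (E : set cantor_space) :
  (forall c c', agree N c c' -> E c -> E c') -> open E.
Proof.
move=> hE; rewrite openE => c Ec; rewrite /interior.
have : nbhs c [set c' | agree N c c'].
  elim: N {hE} => [|N IH]; first by apply: filterS filterT => c' _ i.
  have hN : nbhs c [set c' : cantor_space | c' N = c N].
    exact: (@proj_continuous nat (fun=> bool) N c [set c N] (@discrete_set1 bool _)).
  near=> c' => i; rewrite ltnS leq_eqVlt => /orP[/eqP ->|].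
    by apply/esym; near: c'.
  by move: i; near: c'.
by apply: filterS => c' /hE; exact.
Unshelve. all: by end_near. Qed.

Lemma open_agreeP (E : set cantor_space) c : open E -> E c ->
  exists N, forall c', agree N c c' -> E c'.
Proof.
move=> oE Ec; apply: contrapT => /forallNP h.
(* If every cylinder around c met the complement of E, these intersections
   would have a common point, which could only be c. *)
have [||||c' hc'] := @compact_nested cantor_space
    (fun N => [set c' | agree N c c'] `&` ~` E).
- exact: cantor_space_compact.
- move=> N; apply: closedI; last exact: open_closedC.
  rewrite -[X in closed X]setCK; apply: open_closedC.
  apply: (@open_agree N) => a b ab /= ca cb; apply: ca => i iN.
  by rewrite cb // ab.
- by move=> N; have /existsNP[c' /not_implyP] := h N; exists c'.
- by move=> N c' [cc' nE]; split => //; exact: agree_leq cc'.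
have cE : c = c' by apply/funext => i; apply: (hc' i.+1).1.
by have [_] := hc' 0%N; rewrite -cE.
Qed.

Section coded_algebra.
Variables (Y : Type) (B : nat -> set Y).

Definition same_code (N : nat) (y y' : Y) :=
  forall i, (i < N)%N -> B i y <-> B i y'.

(** The algebra of sets generated by the sets B i, described by the dependence on
    finitely many of them; the Boolean closure properties are then immediate. *)
Definition coded_set (A : set Y) :=
  exists N, forall y y', same_code N y y' -> A y -> A y'.

Lemma same_code_leq N M y y' : (N <= M)%N -> same_code M y y' -> same_code N y y'.
Proof. by move=> NM h i iN; apply: h; exact: leq_trans NM. Qed.

Lemma same_code_sym N y y' : same_code N y y' -> same_code N y' y.
Proof. by move=> h i iN; split => /(h i iN). Qed.

Lemma coded_setC A : coded_set A -> coded_set (~` A).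
Proof.
move=> [N hA]; exists N => y y' yy' nA A'; apply: nA.
exact: hA (same_code_sym yy') A'.
Qed.

Lemma coded_setI : setI_closed coded_set.
Proof.
move=> A A' [N hA] [M hA']; exists (maxn N M) => y y' yy' [Ay A'y]; split.
  by apply: hA Ay; apply: same_code_leq yy'; exact: leq_maxl.
by apply: hA' A'y; apply: same_code_leq yy'; exact: leq_maxr.
Qed.

Lemma coded_set_base j : coded_set (B j).
Proof. by exists j.+1 => y y' yy' By; apply/(yy' j). Qed.

Lemma coded_setT : coded_set setT.
Proof. by exists 0%N. Qed.

(** An enumeration of the algebra, from which a single null set is obtained for all
    of its members. *)
Definition coded_enum (p : nat * seq (seq bool)) : set Y :=
  [set y | [seq `[< B i y >] | i <- iota 0 p.1] \in p.2].

Lemma coded_enum_coded p : coded_set (coded_enum p).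
Proof.
case: p => N s; exists N => y y' yy'; rewrite /coded_enum/=.
suff -> : [seq `[< B i y >] | i <- iota 0 N] = [seq `[< B i y' >] | i <- iota 0 N].
  by [].
apply/eq_in_map => i; rewrite mem_iota add0n => /andP[_ iN].
by apply: asbool_equiv_eq; exact: yy'.
Qed.

Lemma coded_setP A : coded_set A -> exists p, A = coded_enum p.
Proof.
move=> [N hA].
pose code y := [seq `[< B i y >] | i <- iota 0 N].
have szc y : size (code y) == N by rewrite size_map size_iota.
have codeE y y' : code y = code y' -> same_code N y y'.
  move=> /eq_in_map h i iN; apply: asbool_eq_equiv; apply: (h i).
  by rewrite mem_iota.
exists (N, [seq tval t | t : N.-tuple bool <- enum {: N.-tuple bool} &
             `[< exists2 y, A y & code y = t >]]).
apply/seteqP; split => y; rewrite /coded_enum/= -/(code y).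
  move=> Ay; apply/mapP; exists (Tuple (szc y)) => //.
  by rewrite mem_filter mem_enum andbT; apply/asboolP; exists y.
move=> /mapP[t]; rewrite mem_filter => /andP[/asboolP[y' Ay' <-] _] /codeE.
by move=> /same_code_sym yy'; exact: hA yy' Ay'.
Qed.

End coded_algebra.

Lemma coded_set_measurable d (Y : measurableType d) (B : nat -> set Y) A :
  (forall j, measurable (B j)) -> coded_set B A -> measurable A.
Proof.
move=> mB [N]; elim: N A => [|N IH] A hA.
  have [[y Ay]|/forallNP A0] := pselect (exists y, A y).
    rewrite (_ : A = setT) //; apply/seteqP; split => // y' _.
    by apply: hA Ay.
  by rewrite (_ : A = set0) //; apply/seteqP; split => // y' /A0.
pose A1 := [set y | exists y', [/\ A y', same_code B N y' y & B N y']].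
pose A2 := [set y | exists y', [/\ A y', same_code B N y' y & ~ B N y']].
have same_trans x y z : same_code B N x y -> same_code B N y z -> same_code B N x z.
  move=> xy yz i iN; rewrite xy//; exact: yz.
have mA1 : measurable A1.
  apply: IH => y y' yy' [z [Az zy Bz]]; exists z; split => //.
  exact: same_trans yy'.
have mA2 : measurable A2.
  apply: IH => y y' yy' [z [Az zy Bz]]; exists z; split => //.
  exact: same_trans yy'.
rewrite (_ : A = (B N `&` A1) `|` (~` B N `&` A2)).
  apply: measurableU; apply: measurableI => //; exact: measurableC.
apply/seteqP; split => y.
  by move=> Ay; have [By|nBy] := pselect (B N y); [left|right]; split => //; exists y.
move=> [[By [z [Az zy Bz]]]|[By [z [Az zy Bz]]]]; apply: hA Az => i;
  rewrite ltnS leq_eqVlt => /orP[/eqP ->|/zy//]; by split.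
Qed.

(** A copy of the product, so that the algebra of cylinders can be attached to it
    as its family of measurable sets. *)
Definition coded_space (Y : Type) (B : nat -> set Y) : Type :=
  (cantor_space * Y)%type.

HB.instance Definition _ (Y : pointedType) (B : nat -> set Y) :=
  Pointed.on (coded_space B).

Definition cylinder (Y : Type) (B : nat -> set Y) (E : set (cantor_space * Y)) :=
  exists N, forall c c' y y', agree N c c' -> same_code B N y y' ->
    E (c, y) -> E (c', y').

Section cylinders.
Variables (Y : pointedType) (B : nat -> set Y).

Lemma cylinder0 : cylinder B set0.
Proof. by exists 0%N. Qed.

Lemma cylinderC E : cylinder B E -> cylinder B (~` E).
Proof.
move=> [N hE]; exists N => c c' y y' cc' yy' nE E'; apply: nE.
exact: hE (agree_sym cc') (same_code_sym yy') E'.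
Qed.

Lemma cylinderU : setU_closed (cylinder B).
Proof.
move=> E F [N hE] [M hF]; exists (maxn N M) => c c' y y' cc' yy' [h|h].
  left; apply: hE h; [apply: agree_leq cc'|apply: same_code_leq yy'];
    exact: leq_maxl.
right; apply: hF h; [apply: agree_leq cc'|apply: same_code_leq yy'];
  exact: leq_maxr.
Qed.

Lemma cylinder_setX N a A : coded_set B A ->
  cylinder B ([set c | agree N a c] `*` A).
Proof.
move=> [M hA]; exists (maxn N M) => c c' y y' cc' yy' [/= ac Ay]; split => /=.
  by move=> i iN; rewrite ac// cc'// (leq_trans iN)// leq_maxl.
by apply: hA Ay; apply: same_code_leq yy'; exact: leq_maxr.
Qed.

HB.instance Definition _ :=
  @isAlgebraOfSets.Build default_measure_display (coded_space B) (cylinder B)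
    cylinder0 cylinderU cylinderC.

End cylinders.

Section extension.
Context (R : realType) d (Y : measurableType d) (nu : probability Y R).
Variables (B : nat -> set Y) (m : set (cantor_space * Y) -> R).
Hypothesis mB : forall j, measurable (B j).
Hypothesis m_ge0 : forall E, 0 <= m E.
Hypothesis mD : forall E F, E `&` F = set0 -> m (E `|` F) = m E + m F.
Hypothesis mT : m setT = 1.
Hypothesis m_nu : forall A, coded_set B A -> (m (setT `*` A))%:E = nu A.

Let m0 : m set0 = 0.
Proof.
have := mD (setI0 set0); rewrite setU0 => /eqP.
by rewrite -subr_eq subrr eq_sym => /eqP.
Qed.

Let m_le E F : E `<=` F -> m E <= m F.
Proof.
move=> EF; rewrite -(setDUK EF) mD ?lerDl ?m_ge0//.
by apply/seteqP; split => // p [? []].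
Qed.

Let m_bigsetU (F : nat -> set (cantor_space * Y)) n : trivIset setT F ->
  m (\big[setU/set0]_(0 <= i < n) F i) = \sum_(0 <= i < n) m (F i).
Proof.
move=> tF; elim: n => [|n IH]; first by rewrite !big_nil.
rewrite !big_nat_recr//= mD ?IH//.
rewrite big_mkord -bigcup_mkord; apply/seteqP; split => // p [[i /= ni Fi] Fn].
by move: ni; rewrite (tF i n I I (ex_intro _ p (conj Fi Fn))) ltnn.
Qed.

(** By compactness of the Cantor space, the projections to Y of cylinders that
    decrease to the empty set decrease to the empty set as well; the projections
    are coded sets, and m is dominated by nu on them. *)
Lemma cylinder_decreasing_to0 (E : nat -> set (cantor_space * Y)) :
  (forall n, cylinder B (E n)) -> (forall n, E n.+1 `<=` E n) ->
  \bigcap_n E n = set0 -> (m (E n))%:E @[n --> \oo] --> 0%E.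
Proof.
move=> cE ES E0.
pose A n := [set y | exists c, E n (c, y)].
have cA n : coded_set B (A n).
  have [N hN] := cE n; exists N => y y' yy' [c Ec]; exists c.
  exact: hN Ec.
have mA n : measurable (A n) by exact: coded_set_measurable (cA n).
have A0 : \bigcap_n A n = set0.
  apply/seteqP; split => // y Ay.
  have [||||c hc] := @compact_nested cantor_space (fun n => [set c | E n (c, y)]).
  - exact: cantor_space_compact.
  - move=> n; rewrite -[X in closed X]setCK; apply: open_closedC.
    have [N hN] := cylinderC (cE n).
    by apply: (@open_agree N) => c c' cc'; exact: hN.
  - by move=> n; have := Ay n I.
  - by move=> n c; exact: ES.
  by have : (\bigcap_n E n) (c, y); [move=> n _; exact: hc|rewrite E0].
have nuA : nu \o A @ \oo --> nu (\bigcap_n A n).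
  apply: nonincreasing_cvg_mu => //.
  - by rewrite ltey_eq fin_num_measure.
  - exact: bigcapT_measurable.
  - apply/nonincreasing_seqP => n; apply/subsetPset => y [c Ec].
    by exists c; exact: ES.
rewrite A0 measure0 in nuA.
apply: (squeeze_cvge _ (cvg_cst 0%E) nuA); apply: nearW => n.
rewrite lee_fin m_ge0/= -m_nu// lee_fin; apply: m_le => -[c y] Ecy.
by split => //; exists c.
Qed.

Let mu (E : set (coded_space B)) : \bar R := (m E)%:E.

Lemma cylinder_sigma_additive : semi_sigma_additive mu.
Proof.
move=> F cF tF cU.
pose r n := \bigcup_n F n `\` \big[setU/set0]_(0 <= i < n) F i.
have mr n : m (\bigcup_n F n) = \sum_(0 <= i < n) m (F i) + m (r n).
  have sub : \big[setU/set0]_(0 <= i < n) F i `<=` \bigcup_n F n.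
    by rewrite big_mkord; exact: bigsetU_bigcup.
  rewrite -m_bigsetU// -mD ?setDUK//.
  by apply/seteqP; split => // p [? []].
rewrite (_ : (fun n => _) = fun n => ((m (\bigcup_n F n))%:E - (m (r n))%:E)%E).
  rewrite -[X in _ --> X]sube0; apply: cvgeB => //; first exact: cvg_cst.
  apply: cylinder_decreasing_to0.
  - move=> n; have : measurable (r n : set (coded_space B)); last by [].
    apply: measurableD => //; rewrite big_mkord.
    by apply: bigsetU_measurable => i _; exact: cF.
  - move=> n p [Up nF]; split => //; apply: contra_not nF.
    by rewrite big_nat_recr//=; left.
  - apply/seteqP; split => // p h; have [[i _ Fi] _] := h 0%N I.
    by have [_] := h i.+1 I; apply; rewrite big_nat_recr//=; right.
apply/funext => n; rewrite (mr n) -EFinB addrK sumEFin.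
by [].
Qed.

(** A content on cylinders is a premeasure as soon as its marginal on the coded sets
    comes from a measure. *)
Lemma cylinder_extension :
  exists P : probability (g_sigma_algebraType (@cylinder Y B)) R,
    forall E, cylinder B E -> P E = (m E)%:E.
Proof.
pose mx := isMeasure.Build _ (coded_space B) R mu (congr1 EFin m0)
  (fun E => m_ge0 E) cylinder_sigma_additive.
pose mu' : {measure set (coded_space B) -> \bar R} := HB.pack mu mx.
pose P := measure_extension mu'.
have PE E : cylinder B E -> P E = (m E)%:E.
  by move=> cE; rewrite /P/measure_extension measurable_mu_extE.
have P1 : P setT = 1%E by rewrite PE ?mT//; exact: (@measurableT _ (coded_space B)).
pose px := Measure_isProbability.Build _ _ _ P P1.
pose P' : probability (g_sigma_algebraType (@cylinder Y B)) R := HB.pack P px.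
by exists P'.
Qed.

End extension.

(** * Measures from finitely additive joinings *)

Definition open_rectangles (X : topologicalType) (Y : Type) (W : set (set Y)) :=
  [set E | exists (G : set X) (A : set Y), [/\ open G, W A & E = G `*` A]].

Lemma rect_union_generated (X : topologicalType) (Y : Type) (W : set (set Y))
    (E : set (X * Y)) : rect_union W E -> <<s @open_rectangles X Y W >> E.
Proof.
move=> [I [G [A [oG WA ->]]]] Q [sQ rQ].
pose F n := if @choice.unpickle I n is Some i then G i `*` A i else set0.
rewrite (_ : [set p | _] = \bigcup_n F n).
  case: (sQ) => _ _; apply => n; rewrite /F.
  case: choice.unpickle => [i|]; last by case: sQ.
  by apply: rQ; exists (G i), (A i).
apply/seteqP; split => p.
  by move=> [i GA]; exists (choice.pickle i) => //; rewrite /F choice.pickleK.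
move=> [n _]; rewrite /F; case: choice.unpickle => // i GA; by exists i.
Qed.

Section joining_measure.
Context (R : realType) (X : pmetricType R) (Y : ptopologicalType).
Hypothesis cX : compact [set: X].
Variables (B : nat -> set Y) (U : nat -> set Y) (nu : probability (borel Y) R).
Hypothesis mB : forall j, measurable (B j : set (borel Y)).
Hypothesis bU : countable_base U.
Hypothesis UB : forall j, coded_set B (U j).
Variable m : set (X * Y) -> R.
Hypothesis m_ge0 : forall E, 0 <= m E.
Hypothesis mD : forall E F, E `&` F = set0 -> m (E `|` F) = m E + m F.
Hypothesis mT : m setT = 1.
Hypothesis m_nu : forall A, coded_set B A -> (m (setT `*` A))%:E = nu A.

Lemma content_le E F : E `<=` F -> m E <= m F.
Proof.
move=> EF; rewrite -(setDUK EF) mD ?lerDl ?m_ge0//.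
by apply/seteqP; split => // p [? []].
Qed.

Lemma rect_union_coded_measurable (E : set (X * Y)) :
  rect_union (coded_set B) E -> measurable (E : set (borel (X * Y)%type)).
Proof.
move=> oE; apply: rect_union_measurable; apply: sub_rect_union oE => A.
exact: (@coded_set_measurable _ (borel Y)).
Qed.

(** After lifting to the Cantor space, an open first side is a countable union of
    cylinders. *)
Lemma rect_union_code_preimage (pi : cantor_space -> X) (E : set (X * Y)) :
  continuous pi -> rect_union (coded_set B) E ->
  exists F : nat -> set (cantor_space * Y),
    [/\ forall n, cylinder B (F n), nondecreasing_seq F &
        \bigcup_n F n = [set p | E (pi p.1, p.2)]].
Proof.
move=> cpi [I [G [A [oG cA ->]]]].
pose a (w : seq bool) : cantor_space := fun i => nth false w i.
pose F (p : I * seq bool) : set (cantor_space * Y) :=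
  if `[< forall c, agree (size p.2) (a p.2) c -> G p.1 (pi c) >]
  then [set c | agree (size p.2) (a p.2) c] `*` A p.1 else set0.
have cF p : cylinder B (F p).
  rewrite /F; case: asboolP => _; last exact: cylinder0.
  exact: cylinder_setX.
pose F' n := if @choice.unpickle (I * seq bool)%type n is Some p then F p else set0.
have cF' n : cylinder B (F' n).
  rewrite /F'; case: choice.unpickle => // *; exact: cylinder0.
exists (fun n => \big[setU/set0]_(i < n) F' i); split.
- move=> n; elim: n => [|n IH]; first by rewrite big_ord0; exact: cylinder0.
  by rewrite big_ord_recr; exact: cylinderU.
- by apply/nondecreasing_seqP => n; apply/subsetPset; rewrite big_ord_recr; left.
rewrite (_ : \bigcup_n _ = \bigcup_n F' n); last first.
  apply/seteqP; split => p.
    move=> [n _]; rewrite -bigcup_mkord => -[i /= _ Fi]; by exists i.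
  move=> [i _ Fi]; exists i.+1 => //; rewrite -bigcup_mkord.
  by exists i => /=.
apply/seteqP; split => -[c y] /=.
  move=> [n _]; rewrite /F'; case: choice.unpickle => // -[i w].
  rewrite /F/=; case: asboolP => // h [/= /h Gc Ay].
  by exists i.
move=> [i [Gc Ay]].
have oGi : open (pi @^-1` G i) by apply: open_comp => // ? _; exact: cpi.
have [N hN] := open_agreeP oGi Gc.
have aE : agree N (a (mkseq c N)) c by move=> k kN; rewrite /a nth_mkseq.
exists (choice.pickle (i, mkseq c N)) => //.
rewrite /F' choice.pickleK /F/= size_mkseq; case: asboolP => // h; exfalso.
apply: h => c' ac'; apply: hN => k kN.
by rewrite -(aE k kN); exact: ac'.
Qed.

(** Being defined on all sets, the content m can be carried to the Cantor space by an
    arbitrary section of the surjection onto X.  The inequality is the one-sided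
    form of the portmanteau theorem that survives: lambda and m agree on cylinders,
    and a union of rectangles is exhausted by cylinders after lifting. *)
Lemma joining_measure : exists lambda : probability (borel (X * Y)%type) R,
  (forall E, rect_union (coded_set B) E -> (lambda E <= (m E)%:E)%E) /\
  (forall A : set (borel Y), measurable A ->
    lambda ((snd : borel (X * Y)%type -> borel Y) @^-1` A) = nu A).
Proof.
have [f cf] := cantor_surj cX (@metric_hausdorff R X).
pose pi : cantor_space -> X := f.
have /choice[psi psiK] : forall x : X, exists c, pi c = x.
  by move=> x; have [c _ <-] := 'surj_f (I : [set: X] x); exists c.
pose lift (F : set (cantor_space * Y)) := [set p | F (psi p.1, p.2)].
have [||||P PE] := @cylinder_extension R _ (borel Y) nu B (m \o lift) mB.
- by move=> F /=; exact: m_ge0.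
- by move=> E F EF /=; rewrite -mD//; apply/seteqP; split => // p [Ep Fp];
    have : (E `&` F) (psi p.1, p.2) by []; rewrite EF.
- by rewrite /= -mT; congr m.
- move=> A cA; rewrite -m_nu//=; congr ((m _)%:E).
pose psi' (p : coded_space B) : X * Y := (pi p.1, p.2).
have mpsi : measurable_fun setT
    (psi' : g_sigma_algebraType (@cylinder Y B) -> borel (X * Y)%type).
  apply: generated_measurable => E oE.
  have [F [cF _ UF]] := rect_union_code_preimage cf (rect_union_open bU UB oE).
  rewrite [X in measurable X](_ : _ = \bigcup_n F n); last by rewrite UF.
  by apply: bigcupT_measurable => n; exact: sub_sigma_algebra.
have [lam lamE] := pushforward_probability P mpsi.
have lam_le E : rect_union (coded_set B) E -> (lam E <= (m E)%:E)%E.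
  move=> oE; have [F [cF ndF UF]] := rect_union_code_preimage cf oE.
  rewrite lamE [X in P X](_ : _ = \bigcup_n F n); last by rewrite UF.
  have mF n : measurable (F n : set (g_sigma_algebraType (@cylinder Y B))).
    exact: sub_sigma_algebra.
  have /cvg_lim <- // : P \o F @ \oo --> P (\bigcup_n F n).
    by apply: nondecreasing_cvg_mu => //; exact: bigcupT_measurable.
  apply: lime_le.
    apply/cvg_ex; eexists; apply: nondecreasing_cvg_mu => //.
    exact: bigcupT_measurable.
  apply: nearW => n /=; rewrite PE// lee_fin; apply: content_le => -[x y] Fxy.
  have : (\bigcup_n F n) (psi x, y) by exists n.
  by rewrite UF /= -[f _]/(pi _) psiK.
exists lam; split => // A mA.
have cA1 A1 : coded_set B A1 -> lam (setT `*` A1) = nu A1.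
  move=> cA; rewrite -m_nu// lamE.
  have -> : psi' @^-1` (setT `*` A1) = [set c | agree 0 point c] `*` A1.
    by apply/seteqP; split => -[c y] [].
  rewrite PE; last exact: cylinder_setX.
  by congr (m _)%:E; apply/seteqP; split => -[x y] [].
have [Q QE] := pushforward_probability lam (@borel_measurable_snd _ _).
rewrite -QE; apply: (@finite_measure_unique _ R (borel Y) (coded_set B)).
- exact: coded_setI.
- exact: coded_setT.
- by move=> A1; exact: (@coded_set_measurable _ (borel Y)).
- by rewrite ltey_eq fin_num_measure.
- move=> A1 cA; transitivity (lam (setT `*` A1)); last exact: cA1.
  apply: (etrans (QE A1)); congr (lam _).
  by apply/seteqP; split => p //= [].
- move: mA; apply: smallest_sub; first exact: smallest_sigma_algebra.
  move=> V oV D [[D0 _ DU] cD].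
  rewrite (_ : V = \bigcup_j (if `[< U j `<=` V >] then U j else set0)).
    by apply: DU => j; case: ifP => // _; exact: cD.
  apply/seteqP; split => y.
    move=> Vy; have [j [Uy UV]] := bU.2 y V (open_nbhs_nbhs (conj oV Vy)).
    by exists j => //; case: asboolP.
  by move=> [j _]; case: asboolP => // UV /UV.
Qed.

Variables (S : X -> X) (T : Y -> Y).
Hypothesis cS : continuous S.
Hypothesis BT : forall A, coded_set B A -> coded_set B (T @^-1` A).
Let tau (p : X * Y) : X * Y := (S p.1, T p.2).
Hypothesis m_inv : forall E, m (tau @^-1` E) = m E.

(** H n is the interior, and C n the closure, of the set of the points whose ball
    of radius 1/(n+1) lies in G. *)
Lemma open_erosion (G : set X) : open G ->
  exists (H C : nat -> set X),
  [/\ forall n, open (H n), forall n, closed (C n), forall n, H n `<=` C n,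
      forall n, C n `<=` G & nondecreasing_seq H /\ \bigcup_n H n = G].
Proof.
move=> oG; pose K n := [set x : X | ball x (n.+1%:R^-1 : R) `<=` G].
have KS n k : (n <= k)%N -> K n `<=` K k.
  move=> nk x Kx y xy; apply: Kx; apply: le_ball xy.
  by rewrite lef_pV2 ?posrE// ler_nat.
exists (fun n => (K n)^°), (fun n => closure (K n)); split.
- by move=> n; exact: open_interior.
- by move=> n; exact: closed_closure.
- by move=> n x /interior_subset; exact: subset_closure.
- move=> n x Kx; have [y [Ky xy]] := Kx _ (nbhsx_ballx x (n.+1%:R^-1 : R) ltac:(by rewrite invr_gt0)).
  by apply: Ky; exact: ball_sym.
split.
  by apply/nondecreasing_seqP => n; apply/subsetPset; apply: interiorS; exact: KS.
apply/seteqP; split => x.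
  by move=> [n _ /interior_subset Kx]; apply: Kx; apply: ballxx; rewrite invr_gt0.
move=> Gx; have /nbhs_ballP[e /= e0 xG] := open_nbhs_nbhs (conj oG Gx).
pose n := Num.truncn (2 / e); have ngt : n.+1%:R^-1 < e / 2.
  by rewrite invf_plt ?posrE ?divr_gt0// invf_div; exact: truncnS_gt.
exists n => //; apply/nbhs_ballP; exists (e / 2) => /=; first by rewrite divr_gt0.
move=> y xy z yz; apply: xG.
apply: le_ball (ball_triangle xy yz).
by rewrite [leRHS]splitr lerD2l ltW.
Qed.

Lemma coded_closed_measurable (C : set X) A : closed C -> coded_set B A ->
  measurable (C `*` A : set (borel (X * Y)%type)).
Proof.
move=> cC cA.
rewrite (_ : C `*` A = (setT `*` A) `\` (~` C `*` A)).
  apply: measurableD; apply: rect_union_coded_measurable; apply: rect_union_rect => //.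
    exact: openT.
  exact: closed_openC.
apply/seteqP; split => p /=.
  by move=> [Cp Ap]; split => // -[].
by move=> [[_ Ap] h]; split => //; apply: contrapT => nC; exact: h.
Qed.

(** If H is open, C is closed and H `<=` C, then lambda (H x A) <= m (H x A) <=
    m (C x A) <= lambda (C x A), the last inequality by complementation.  The
    invariance of m can be used in the middle of this chain, in both directions,
    and an open G is exhausted by sets H with C `<=` G.  So lambda and its image
    agree on open rectangles, which generate the Borel sets. *)
Lemma joining_invariant (lambda : probability (borel (X * Y)%type) R) :
  (forall E, rect_union (coded_set B) E -> (lambda E <= (m E)%:E)%E) ->
  (forall A : set (borel Y), measurable A ->
    lambda ((snd : borel (X * Y)%type -> borel Y) @^-1` A) = nu A) ->
  measurable_fun setT (T : borel Y -> borel Y) ->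
  invariant_measure (tau : borel (X * Y)%type -> borel (X * Y)%type) lambda.
Proof.
move=> lam_le lam_nu mTT.
have mtau : measurable_fun setT (tau : borel (X * Y)%type -> borel (X * Y)%type).
  exact: measurable_prod_map bU (continuous_borel cS) mTT.
have mcoded A : coded_set B A -> measurable (A : set (borel Y)).
  exact: (@coded_set_measurable _ (borel Y)).
have lamTA A : coded_set B A -> lambda (setT `*` A) = nu A.
  move=> cA; apply: etrans (lam_nu A (mcoded _ cA)); congr (lambda _).
  by apply/seteqP; split => p //= [].
have le_closed (C : set X) A : closed C -> coded_set B A ->
    ((m (C `*` A))%:E <= lambda (C `*` A))%E.
  move=> cC cA.
  have oC : open (~` C) by exact: closed_openC.
  have oCA : rect_union (coded_set B) (~` C `*` A) by exact: rect_union_rect.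
  have mCA := coded_closed_measurable cC cA.
  have mCA' := rect_union_coded_measurable oCA.
  have disj : (~` C `*` A) `&` (C `*` A) = set0.
    by apply/seteqP; split => // p [[/= nC _] [C' _]]; exact: nC.
  have uni : (~` C `*` A) `|` (C `*` A) = setT `*` A.
    apply/seteqP; split => p /=; first by move=> [[]|[]].
    by move=> [_ Ap]; have [Cp|nCp] := pselect (C p.1); [right|left].
  have h1 := m_nu cA; rewrite -lamTA// -uni measureU// ?uni// in h1.
  rewrite -{}uni mD// EFinD in h1.
  have fin := fin_num_measure lambda (C `*` A) mCA.
  have h2 := lam_le _ oCA.
  rewrite leNgt; apply/negP => h3.
  have : (lambda (~` C `*` A) + lambda (C `*` A) < (m (~` C `*` A))%:E + (m (C `*` A))%:E)%E.
    by apply: lee_ltD => //; exact: fin_num_measure.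
  by rewrite h1 ltxx.
have le_rect (G : set X) A (c : \bar R) : open G -> coded_set B A ->
   forall f : borel (X * Y)%type -> borel (X * Y)%type, measurable_fun setT f ->
   (forall H C : set X, open H -> closed C -> H `<=` C -> C `<=` G ->
     (lambda (f @^-1` (H `*` A)) <= c)%E) ->
   (lambda (f @^-1` (G `*` A)) <= c)%E.
  move=> oG cA f mf h.
  have [H [C [oH cC HC CG [ndH UH]]]] := open_erosion oG.
  have mfH n : measurable (f @^-1` (H n `*` A)).
    rewrite -[X in measurable X]setTI; apply: mf => //.
    by apply: rect_union_coded_measurable; exact: rect_union_rect.
  have := @nondecreasing_cvg_mu _ _ _ lambda (fun n => f @^-1` (H n `*` A)) mfH
    (bigcupT_measurable _ mfH).
  have -> : \bigcup_n (f @^-1` (H n `*` A)) = f @^-1` (G `*` A).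
    rewrite -UH; apply/seteqP; split => p /=.
      by move=> [n _ [Hn Ap]]; split => //; exists n.
    by move=> [[n _ Hn] Ap]; exists n.
  have ndf : nondecreasing_seq (fun n => f @^-1` (H n `*` A)).
    apply/nondecreasing_seqP => n; apply/subsetPset => p [Hn Ap]; split => //.
    by have /subsetPset := ndH n n.+1 (leqnSn n); apply.
  move=> /(_ ndf) cvgf; rewrite -(cvg_lim _ cvgf)//.
  apply: lime_le; first by apply/cvg_ex; eexists; exact: cvgf.
  by apply: nearW => n; exact: (h (H n) (C n)).
have inv_rect (G : set X) A : open G -> coded_set B A ->
    lambda (tau @^-1` (G `*` A)) = lambda (G `*` A).
  move=> oG cA.
  have mG : measurable (G `*` A : set (borel (X * Y)%type)).
    by apply: rect_union_coded_measurable; exact: rect_union_rect.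
  have mtauG : measurable (tau @^-1` (G `*` A) : set (borel (X * Y)%type)).
    by rewrite -[X in measurable X]setTI; exact: mtau.
  have otau (H : set X) : open H -> rect_union (coded_set B) (tau @^-1` (H `*` A)).
    move=> oH; apply: (@rect_union_preimage _ _ _ _ (coded_set B) _ S T (H `*` A)) => //.
    exact: rect_union_rect.
  apply/eqP; rewrite eq_le; apply/andP; split.
    apply: le_rect => // H C oH cC HC CG.
    apply: (le_trans (lam_le _ (otau _ oH))); rewrite m_inv.
    apply: (@le_trans _ _ (m (C `*` A))%:E).
      by rewrite lee_fin; apply: content_le => p [/HC].
    apply: (le_trans (le_closed _ _ cC cA)); apply: le_measure; rewrite ?inE//.
      exact: coded_closed_measurable.
    by move=> p [/CG].
  apply: (le_rect _ _ _ oG cA id) => // H C oH cC HC CG.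
  rewrite preimage_id; apply: (le_trans (lam_le _ (rect_union_rect oH cA))).
  rewrite -m_inv; apply: (@le_trans _ _ (m (tau @^-1` (C `*` A)))%:E).
    by rewrite lee_fin; apply: content_le => p [/HC].
  have cSC : closed (S @^-1` C) by apply: closed_comp => // ? _; exact: cS.
  have := le_closed _ _ cSC (BT cA).
  move=> /le_trans; apply; apply: le_measure; rewrite ?inE//.
    exact: coded_closed_measurable (BT cA).
  by move=> p [/CG].
move=> E mE.
have [Q QE] := pushforward_probability lambda mtau.
rewrite -QE.
apply: (@finite_measure_unique _ R (borel (X * Y)%type) (@open_rectangles X Y (coded_set B))).
- move=> _ _ [G [A [oG cA ->]]] [G' [A' [oG' cA' ->]]].
  exists (G `&` G'), (A `&` A'); split; [exact: openI|exact: coded_setI|].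
  by rewrite setXI.
- by exists setT, setT; split; [exact: openT|exact: coded_setT|rewrite setXTT].
- move=> _ [G [A [oG cA ->]]]; apply: rect_union_coded_measurable; exact: rect_union_rect.
- by rewrite ltey_eq fin_num_measure.
- by move=> _ [G [A [oG cA ->]]]; apply: (etrans (QE _)); exact: inv_rect.
- move: mE; apply: smallest_sub; first exact: smallest_sigma_algebra.
  by move=> V oV; apply: rect_union_generated; exact: rect_union_open bU UB oV.
Qed.

End joining_measure.

(** * Limit frequencies along an ultrafilter *)

Lemma ultra_bounded_cvg (R : realType) (F : set_system nat) (f : nat -> R) a b :
  UltraFilter F -> (forall i, a <= f i <= b) -> cvg (f @ F).
Proof.
move=> FU fab.
have PF : ProperFilter F by exact: ultra_proper.
have [|p [_ clp]] := @segment_compact R a b (f @ F) _ _.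
  have : F [set i | `[a, b]%classic (f i)].
    by apply: filterS filterT => i _; rewrite set_itvcc; exact: fab.
  exact.
apply/cvg_ex; exists p => A pA.
have [//|FA] := in_ultra_setVsetC (f @^-1` A) FU.
have [q [nAq Aq]] := clp (~` A) A FA pA.
by [].
Qed.

Section empirical.
Context (R : realType) (Z : Type) (tau : Z -> Z) (F : set_system nat).
Context {FU : UltraFilter F}.
Variables (n : nat -> nat) (z : nat -> Z).
Hypothesis n_oo : forall N, F [set i | (N <= n i)%N].

Let a (g : Z -> R) i := average tau g (n i) (z i).

(** The limit frequency of visits to E of the orbit segments that start at z i and
    have length n i + 1.  Along an ultrafilter it exists for every set E. *)
Definition empirical (E : set Z) : R := lim (a \1_E @ F).

Let a01 E i : 0 <= a \1_E i <= 1.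
Proof.
apply/andP; split.
  rewrite -[leLHS](average_cst tau 0 (n i) (z i)); apply: average_le => p.
  by have /andP[] := indic01 R E p.
rewrite -[leRHS](average_cst tau 1 (n i) (z i)); apply: average_le => p.
by have /andP[] := indic01 R E p.
Qed.

Lemma empirical_cvg E : a \1_E @ F --> empirical E.
Proof. exact: ultra_bounded_cvg (a01 E). Qed.

Lemma empiricalP E x : a \1_E @ F --> x -> empirical E = x.
Proof. by move=> h; apply: cvg_lim. Qed.

Lemma empirical_ge0 E : 0 <= empirical E.
Proof.
apply: limr_ge; first exact: empirical_cvg.
by apply: filterS filterT => i _; have /andP[] := a01 E i.
Qed.

Lemma empiricalT : empirical setT = 1.
Proof.
apply: empiricalP; rewrite (_ : a _ = cst 1); first exact: cvg_cst.
by apply/funext => i; rewrite /a indicT average_cst.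
Qed.

Lemma empiricalD E E' : E `&` E' = set0 ->
  empirical (E `|` E') = empirical E + empirical E'.
Proof.
move=> EE'; apply: empiricalP.
rewrite (_ : a _ = fun i => a \1_E i + a \1_E' i).
  by apply: cvgD; exact: empirical_cvg.
apply/funext => i; rewrite /a -averageD; congr average.
apply/funext => p; rewrite !indicE in_setU.
have [pE|] := boolP (p \in E); have [pE'|] := boolP (p \in E') => //=;
  rewrite ?addr0 ?add0r//.
by have : (E `&` E') p; [split; apply/set_mem|rewrite EE'].
Qed.

Lemma empirical_sum_le (I : Type) (s : seq I) (E : I -> set Z) c :
  F [set i | \sum_(k <- s) a \1_(E k) i <= c] ->
  \sum_(k <- s) empirical (E k) <= c.
Proof.
move=> Fc.
suff h : (fun i => \sum_(k <- s) a \1_(E k) i) @ F -->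
    \sum_(k <- s) empirical (E k) by exact: (cvgr_to_le h).
elim: s {Fc} => [|k s IH].
  rewrite big_nil (_ : (fun _ => _) = cst 0); first exact: cvg_cst.
  by apply/funext => i; rewrite big_nil.
rewrite big_cons (_ : (fun _ => _) =
   fun i => a \1_(E k) i + \sum_(k <- s) a \1_(E k) i).
  by apply: cvgD => //; exact: empirical_cvg.
by apply/funext => i; rewrite big_cons.
Qed.

Lemma empirical_invariant E : empirical (tau @^-1` E) = empirical E.
Proof.
apply: empiricalP.
rewrite -[empirical E]add0r (_ : a _ = fun i => (a \1_(tau @^-1` E) i - a \1_E i) + a \1_E i).
  apply: cvgD; last exact: empirical_cvg.
  apply/cvgrPdist_le => e e0.
  apply: filterS (n_oo (Num.truncn (e^-1))) => i /= ni.
  rewrite sub0r normrN.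
  have := @average_shift R Z tau \1_E (n i) (z i) _.
  rewrite (_ : \1_E \o tau = \1_(tau @^-1` E)); last first.
    by apply/funext => p; rewrite /= !indicE /= [in RHS]/in_mem.
  move=> /(_ _)/le_trans; apply.
    by move=> p; exact: indic01.
  rewrite invf_ple ?posrE//.
  apply: (le_trans (ltW (truncnS_gt _))).
  by rewrite ler_nat ltnS.
by apply/funext => i; rewrite subrK.
Qed.

End empirical.

(** Counting the positive integers up to M that lie below u recovers u up to an
    error of 1, as long as u is at most M. *)
Lemma count_below (R : realType) (u : R) (M : nat) : 0 <= u ->
  Num.min (u - 1) M%:R <= \sum_(1 <= k < M.+1) ((k%:R < u)%R%:R : R) <= Num.min u M%:R.
Proof.
move=> u0; elim: M => [|M /andP[IH1 IH2]].
  by rewrite big_geq//; rewrite ge_min lexx orbT le_min u0 lexx.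
rewrite big_nat_recr//=; set s := \sum_(1 <= k < _) _ in IH1 IH2 *.
move: IH1 IH2; rewrite !le_min !ge_min -natr1.
case: ltrP => h /=.
  move=> /orP h1 /andP[h2 h3]; apply/andP; split; last by apply/andP; split; lra.
  by apply/orP; right; case: h1; lra.
move=> /orP h1 /andP[h2 h3]; apply/andP; split; last by apply/andP; split; lra.
by apply/orP; left; case: h1; lra.
Qed.

(** A lower approximation of g, with steps of height 1/(N+1) up to the level N+1.
    It is written with superlevel sets, rather than with the sets between two
    levels, because measures and frequencies are compared in one direction only
    and on superlevel sets only. *)
Definition staircase (R : realType) (Z : Type) (g : Z -> R) (N : nat) (p : Z) : R :=
  N.+1%:R^-1 * \sum_(1 <= k < (N.+1 * N.+1).+1) \1_[set q | k%:R / N.+1%:R < g q] p.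

Lemma staircaseE (R : realType) (Z : Type) (g : Z -> R) N p : 
  staircase g N p = N.+1%:R^-1 *
    \sum_(1 <= k < (N.+1 * N.+1).+1) ((k%:R < N.+1%:R * g p)%R%:R : R).
Proof.
congr (_ * _); apply: eq_bigr => k _; rewrite indicE.
rewrite (_ : (p \in _) = (k%:R / N.+1%:R < g p)).
  by rewrite ltr_pdivrMr// mulrC.
by apply/idP/idP; [rewrite inE|move=> h; rewrite inE].
Qed.

Lemma staircase_le (R : realType) (Z : Type) (g : Z -> R) N p : 0 <= g p ->
  staircase g N p <= g p.
Proof.
move=> g0; rewrite staircaseE [leLHS]mulrC ler_pdivrMr// [leRHS]mulrC.
have /(count_below (N.+1 * N.+1)) : 0 <= N.+1%:R * g p by rewrite mulr_ge0.
by move=> /andP[_]; rewrite le_min => /andP[+ _].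
Qed.

Lemma staircase_cvg (R : realType) (Z : Type) (g : Z -> R) p : 0 <= g p ->
  staircase g N p @[N --> \oo] --> g p.
Proof.
move=> g0; apply: (@squeeze_cvgr _ _ _ _ (fun N => g p - N.+1%:R^-1) (fun=> g p)).
- exists (Num.truncn (g p)).+1 => // N /= Ng.
  rewrite staircase_le// andbT staircaseE.
  have /(count_below (N.+1 * N.+1)) /andP[+ _] : 0 <= N.+1%:R * g p by rewrite mulr_ge0.
  rewrite (min_idPl _).
    by rewrite -(ler_pM2l (_ : 0 < N.+1%:R^-1))// ?invr_gt0// mulrBr mulrA mulVf// mul1r mulr1.
  rewrite natrM lerBlDr.
  have gN : g p <= N.+1%:R.
    apply: (le_trans (ltW (truncnS_gt _))); rewrite ler_nat; exact: leqW.
  by apply: ler_wpDr => //; rewrite ler_pM2l.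
- rewrite -[X in _ --> X]subr0; apply: cvgB; first exact: cvg_cst.
  exact: cvg_harmonic.
- exact: cvg_cst.
Qed.

Section integral_bound.
Context (R : realType) d (Z : measurableType d) (lambda : probability Z R).
Variables (tau : Z -> Z) (F : set_system nat).
Context {FU : UltraFilter F}.
Variables (n : nat -> nat) (z : nat -> Z) (g : Z -> R) (c : R).
Hypothesis g0 : forall p, 0 <= g p.
Hypothesis mg : forall t, measurable [set p | t < g p].
Hypothesis lam_le : forall t,
  (lambda [set p | (t < g p)%R] <= (empirical R tau F n z [set p | (t < g p)%R])%:E)%E.
Hypothesis gc : F [set i | average tau g (n i) (z i) <= c].

(** The inequality between measures and frequencies passes from superlevel sets to
    staircases by additivity, and from staircases to g by Fatou's lemma. *)
Lemma integral_le_empirical : (\int[lambda]_p (g p)%:E <= c%:E)%E.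
Proof.
have mind N k : measurable_fun setT
    (fun p : Z => (\1_[set q | k%:R / N.+1%:R < g q] p)%:E : \bar R).
  by apply/measurable_EFinP; exact: measurable_indic.
have stE N p : (staircase g N p)%:E = (N.+1%:R^-1%:E *
    \sum_(1 <= k < (N.+1 * N.+1).+1) (\1_[set q | (k%:R / N.+1%:R < g q)%R] p)%:E)%E.
  by rewrite sumEFin -EFinM.
have msum N : measurable_fun setT (fun p : Z =>
    \sum_(1 <= k < (N.+1 * N.+1).+1) (\1_[set q | (k%:R / N.+1%:R < g q)%R] p)%:E : \bar R)%E.
  by apply: emeasurable_sum => k.
have mst N : measurable_fun setT (fun p => (staircase g N p)%:E).
  under eq_fun do rewrite stE.
  exact: measurable_funeM.
have int_le N : (\int[lambda]_p (staircase g N p)%:E <= c%:E)%E.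
  under eq_integral do rewrite stE.
  rewrite ge0_integralZl_EFin//; last first.
    by move=> p _; apply: sume_ge0 => k _; rewrite lee_fin.
  rewrite ge0_integral_sum//.
  under eq_bigr do rewrite integral_indic// setIT.
  apply: (@le_trans _ _ (N.+1%:R^-1%:E * \sum_(1 <= k < (N.+1 * N.+1).+1)
     (empirical R tau F n z [set q | (k%:R / N.+1%:R < g q)%R])%:E)%E).
    by apply: lee_wpmul2l; [rewrite lee_fin invr_ge0|apply: lee_sum => k _; exact: lam_le].
  rewrite sumEFin -EFinM lee_fin mulrC ler_pdivrMr//.
  apply: empirical_sum_le; apply: filterS gc => i /= h.
  rewrite -average_sum -ler_pdivrMr// mulrC -averageZ; apply: le_trans h.
  by apply: average_le => p; exact: staircase_le.
have -> : (\int[lambda]_p (g p)%:E =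
    \int[lambda]_p limn_einf (fun N => (staircase g N p)%:E))%E.
  apply: eq_integral => p _; apply/esym.
  apply: (cvg_limn_einf_sup _).1; apply: cvg_EFin; last exact: staircase_cvg.
  exact: nearW.
apply: (le_trans (fatou lambda measurableT mst _)).
  move=> N p _; rewrite lee_fin /staircase mulr_ge0//.
  by apply: sumr_ge0 => k _.
rewrite limn_einf_lim; apply: lime_le; first exact: is_cvg_einfs.
apply: nearW => N; apply: ereal_inf_le; exists (\int[lambda]_p (staircase g N p)%:E)%E => //.
by exists N => /=.
Qed.

End integral_bound.

(** * Generic points *)

Section coding_family.
Context (R : realType) (Y : ptopologicalType).
Variables (U : nat -> set Y) (T : Y -> Y) (h : Y -> R).
Hypothesis bU : countable_base U.
Hypothesis mT : measurable_fun setT (T : borel Y -> borel Y).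
Hypothesis mh : measurable_fun setT (h : borel Y -> R).

(** All preimages of the sets U j and of the superlevel sets of h under the iterates
    of T are put in the family, which makes it stable under preimage by T. *)
Lemma coding_family : exists B : nat -> set Y,
  [/\ forall j, measurable (B j : set (borel Y)),
      forall j, coded_set B (U j),
      forall q : rat, coded_set B [set y | ratr q < h y] &
      forall A, coded_set B A -> coded_set B (T @^-1` A)].
Proof.
pose V (v : nat + rat) : set Y :=
  match v with inl j => U j | inr q => [set y | ratr q < h y] end.
pose B n := if @choice.unpickle (nat * (nat + rat))%type n is Some p
  then (iter p.1 T) @^-1` V p.2 else set0.
have BE k v : B (choice.pickle (k, v)) = (iter k T) @^-1` V v.
  by rewrite /B choice.pickleK.
have mV v : measurable (V v : set (borel Y)).
  case: v => [j|q]; first by apply: sub_sigma_algebra; exact: bU.1.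
  rewrite (_ : V _ = h @^-1` `]ratr q, +oo[%classic); last by rewrite preimage_itvoy.
  by rewrite -[X in measurable X]setTI; exact: mh.
have miter k : measurable_fun setT (iter k T : borel Y -> borel Y).
  elim: k => [|k IH]; first exact: measurable_id.
  exact: (measurableT_comp mT).
have VB v : coded_set B (V v).
  have := coded_set_base B (choice.pickle (0%N, v)).
  by rewrite BE.
exists B; split.
- move=> j; rewrite /B; case: choice.unpickle => [p|//].
  by rewrite -[X in measurable X]setTI; exact: miter.
- by move=> j; exact: (VB (inl j)).
- by move=> q; exact: (VB (inr q)).
- move=> A [N hA].
  have /choice[s hs] : forall i, exists j, T @^-1` B i = B j.
    move=> i; rewrite {1}/B.
    case E : (choice.unpickle i) => [p|]; last first.
      by exists i; rewrite /B E preimage_set0.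
    exists (choice.pickle (p.1.+1, p.2)); rewrite BE.
    by apply/seteqP; split => y /=; rewrite -iterSr.
  exists (\max_(i < N) (s i).+1) => y y' yy'; apply: hA => i iN.
  have := yy' (s i); rewrite -hs; apply.
  exact: (leq_bigmax (Ordinal iN)).
Qed.

End coding_family.

Section good_points.
Context (R : realType) (Y : ptopologicalType) (nu : probability (borel Y) R).
Variables (T : Y -> Y) (B : nat -> set Y) (h : Y -> R).

(** Upper bounds suffice for the coded sets, since complements of coded sets are
    coded: see [generic_point_cvg]. *)
Definition generic_point (y : Y) :=
  (forall A, coded_set B A -> forall e, 0 < e ->
     \forall n \near \oo, average T \1_A n y <= fine (nu A) + e) /\
  (forall e, 0 < e ->
     \forall n \near \oo, average T h n y <= fine (\int[nu]_y (h y)%:E) + e).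

Lemma generic_point_cvg y A : (forall j, measurable (B j : set (borel Y))) ->
  generic_point y -> coded_set B A ->
  average T \1_A n y @[n --> \oo] --> fine (nu A).
Proof.
move=> mB [gy _] cA; apply/cvgrPdist_le => e e0.
have mA : measurable (A : set (borel Y)).
  exact: (@coded_set_measurable _ (borel Y) B).
have E n : average T \1_A n y = 1 - average T \1_(~` A) n y :> R.
  apply/eqP; rewrite -subr_eq opprK -averageD -[X in _ == X](average_cst T 1 n y).
  apply/eqP; congr average; apply/funext => p; rewrite !indicE in_setC.
  by case: (p \in A); rewrite ?addr0 ?add0r.
have nuC : fine (nu (~` A)) = 1 - fine (nu A).
  rewrite probability_setC// -[X in fine (X - _)](fineK (x := 1%E))//.
  by rewrite fineB// fin_num_measure.
near=> n.
have h1 : average T \1_A n y <= fine (nu A) + e by near: n; exact: gy.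
have h2 : average T \1_(~` A) n y <= fine (nu (~` A)) + e.
  by near: n; apply: gy => //; exact: coded_setC.
rewrite nuC in h2; move: h1 h2; rewrite E => h1 h2.
rewrite ler_norml; apply/andP; split; lra.
Unshelve. all: by end_near. Qed.

Lemma ae_generic_point : (forall j, measurable (B j : set (borel Y))) ->
  measurable_fun setT (T : borel Y -> borel Y) ->
  invariant_measure (T : borel Y -> borel Y) nu ->
  ergodic (T : borel Y -> borel Y) nu ->
  nu.-integrable setT (EFin \o (h : borel Y -> R)) ->
  {ae nu, forall y, generic_point y}.
Proof.
move=> mB mT Tinv Terg ih.
have mC p : measurable (coded_enum B p : set (borel Y)).
  exact: (@coded_set_measurable _ (borel Y) B _ mB (coded_enum_coded _ _)).
have h1 p : {ae nu, forall y, forall e, 0 < e ->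
    \forall n \near \oo, average T \1_(coded_enum B p) n y <= fine (nu (coded_enum B p)) + e}.
  have := @birkhoff_limsup R _ (borel Y) nu T \1_(coded_enum B p) mT Tinv Terg.
  rewrite integral_indic// setIT; apply.
  exact: (integrable_indic nu (mC p)).
have h2 := @birkhoff_limsup R _ (borel Y) nu T h mT Tinv Terg ih.
apply: filterS2 (ae_forall_countable h1) h2 => y hy1 hy2; split => // A cA.
by have [p ->] := coded_setP cA; exact: hy1.
Qed.

End good_points.

(** * Limit joinings *)

Definition prod_map (X Y : Type) (S : X -> X) (T : Y -> Y) (p : X * Y) : X * Y :=
  (S p.1, T p.2).

Lemma iter_prod_map (X Y : Type) (S : X -> X) (T : Y -> Y) k x y :
  iter k (prod_map S T) (x, y) = (iter k S x, iter k T y).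
Proof. by elim: k => //= k ->. Qed.

Lemma average_snd (R : realType) (X Y : Type) (S : X -> X) (T : Y -> Y)
    (g : Y -> R) n x y :
  average (prod_map S T) (g \o snd) n (x, y) = average T g n y.
Proof.
rewrite /average /birkhoff_sum; congr (_ * _).
by apply: eq_big_nat => k _; rewrite iter_prod_map.
Qed.

Lemma avg_lossE (R : realType) (X Y : Type) (S : X -> X) (T : Y -> Y)
    (l : X * Y -> R) n x y :
  avg_loss S T l n x y = average (prod_map S T) l n (x, y).
Proof.
rewrite /avg_loss /average /birkhoff_sum; congr (_ * _).
by apply: eq_big_nat => k _; rewrite iter_prod_map.
Qed.

Lemma open_far (R : realType) (M : metricType R) (t0 : M) (r : R) :
  open [set t | r < mdist t0 t].
Proof.
rewrite openE => t /= rt; apply/nbhs_ballP; exists (mdist t0 t - r) => /=.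
  by rewrite subr_gt0.
move=> s; rewrite ballEmdist/= => ts.
by have := metric_triangle t0 s t; rewrite (metric_sym s t); lra.
Qed.

Section limit_joining.
Context (R : realType) (X : pmetricType R) (Y : ptopologicalType).
Context (Theta : pmetricType R) (nu : probability (borel Y) R).
Variables (S : X -> X) (T : Y -> Y) (l : X * Y -> R) (lstar : Y -> R).
Variables (phi : X -> Theta).
Variables (U B : nat -> set Y).
Hypothesis bU : countable_base U.
Hypothesis mB : forall j, measurable (B j : set (borel Y)).
Hypothesis UB : forall j, coded_set B (U j).
Hypothesis lB : forall q : rat, coded_set B [set y | ratr q < lstar y].
Hypothesis BT : forall A, coded_set B A -> coded_set B (T @^-1` A).
Hypothesis cX : compact [set: X].
Hypothesis cS : continuous S.
Hypothesis mT : measurable_fun setT (T : borel Y -> borel Y).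
Hypothesis l_lsc : forall t : R, open [set p | t < l p].
Hypothesis lstar_int : nu.-integrable setT (EFin \o (lstar : borel Y -> R)).
Hypothesis l_bounded : forall x y, `|l (x, y)| <= lstar y.
Hypothesis cphi : continuous phi.
Hypothesis phiS : forall x, phi (S x) = phi x.

Let tau := prod_map S T.

Lemma loss_sum_rect_lsc : rect_lsc (coded_set B) (fun p : X * Y => l p + lstar p.2).
Proof.
apply: rect_lscD; first exact: coded_setI.
  by move=> t; apply: (@rect_union_open X Y _ U) => //; exact: l_lsc.
move=> t; rewrite (_ : [set p | _] = \bigcup_(q : rat)
    (if t <= ratr q then setT `*` [set y | ratr q < lstar y] else set0)).
  apply: rect_union_bigcup => q; case: ifP => _; first exact: rect_union_rect openT (lB q).
  rewrite -(set0X [set: Y]); apply: rect_union_rect; [exact: open0|exact: coded_setT].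
apply/seteqP; split => -[x y] /=.
  move=> /rat_in_itvoo[q]; rewrite in_itv/= => /andP[h1 h2].
  by exists q => //; rewrite (ltW h1).
move=> [q _]; case: ifP => // h1 [_ /= h2]; exact: le_lt_trans h2.
Qed.

Lemma measurable_loss : measurable_fun setT (l : borel (X * Y)%type -> R).
Proof.
apply: (measurability _ (RGenOInfty.measurableE R)) => /= _ [_ [a ->]] <-.
rewrite setTI preimage_itvoy; apply: sub_sigma_algebra; exact: l_lsc.
Qed.

Variables (y : Y) (a : R) (theta : Theta).
Hypothesis gen : generic_point nu T B lstar y.
Hypothesis orbits : forall (N : nat) (e : R), 0 < e -> exists n x,
  [/\ (N <= n)%N, mdist theta (phi x) < e &
      average tau l n (x, y) <= a + e].

(** The joining is the measure given by [joining_measure] for the frequencies of the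
    orbit segments.  It sits over theta because phi is constant along orbits of S
    and the parameters of the starting points tend to theta.  As frequencies
    control integrals of nonnegative functions, the bound on the integral is
    obtained for l + lstar; the averages of lstar along a generic orbit are
    asymptotically at most its integral, which can then be subtracted. *)
Lemma limit_joining : exists lambda : probability (borel (X * Y)%type) R,
  [/\ invariant_measure (tau : borel (X * Y)%type -> borel (X * Y)%type) lambda,
      forall A : set (borel Y), measurable A ->
        lambda ((snd : borel (X * Y)%type -> borel Y) @^-1` A) = nu A,
      lambda [set p : X * Y | phi p.1 = theta] = 1%E &
      (\int[lambda]_p (l p)%:E <= a%:E)%E].
Proof.
have /choice[nx hnx] : forall i : nat, exists nx : nat * X,
    [/\ (i <= nx.1)%N, mdist theta (phi nx.2) < i.+1%:R^-1 &
      average tau l nx.1 (nx.2, y) <= a + i.+1%:R^-1].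
  move=> i; have [|n [x h]] := orbits i (e := i.+1%:R^-1).
    by rewrite invr_gt0.
  by exists (n, x).
pose n i := (nx i).1; pose z i : X * Y := ((nx i).2, y).
have [F [FU ooF]] := ultraFilterLemma (eventually_filter).
have near_F (P : nat -> Prop) : (\forall i \near \oo, P i) -> F P by exact: ooF.
have n_oo N : F [set i | (N <= n i)%N].
  apply: near_F; exists N => // i /= Ni.
  by apply: leq_trans Ni _; have [] := hnx i.
have small e : 0 < e -> F [set i | i.+1%:R^-1 < e :> R].
  move=> e0; apply: near_F; exists (Num.truncn e^-1) => // i /= Ni.
  rewrite invf_plt ?posrE//; apply: lt_le_trans (truncnS_gt _) _.
  by rewrite ler_nat ltnS.
pose m := empirical R tau F n z.
have n_near (P : nat -> Prop) : (\forall i \near \oo, P i) -> F [set i | P (n i)].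
  by move=> [N _ hN]; apply: filterS (n_oo N) => i; exact: hN.
have m_nu A : coded_set B A -> (m (setT `*` A))%:E = nu A.
  move=> cA.
  have mA : measurable (A : set (borel Y)).
    exact: (@coded_set_measurable _ (borel Y) B).
  rewrite -(fineK (fin_num_measure nu A mA)); congr EFin.
  have ncvg : n @ F --> \oo by move=> P; exact: n_near.
  apply: empiricalP; rewrite (_ : (fun _ => _) = (fun k => average T \1_A k y) \o n).
    exact: cvg_comp ncvg (generic_point_cvg mB gen cA).
  apply/funext => i /=; rewrite (_ : \1_(setT `*` A) = \1_A \o snd) ?average_snd//.
  apply/funext => p; rewrite /= !indicE; congr (nat_of_bool _)%:R.
  by apply/idP/idP => [/set_mem[_ h]|/set_mem h]; apply/mem_set.
have m_ge0 E : 0 <= m E by exact: empirical_ge0.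
have mD E E' : E `&` E' = set0 -> m (E `|` E') = m E + m E' by exact: empiricalD.
have mT1 : m setT = 1 by exact: empiricalT.
have m_inv E : m (tau @^-1` E) = m E by exact: empirical_invariant.
have [lam [lam_le lam_nu]] := joining_measure cX mB bU UB m_ge0 mD mT1 m_nu.
exists lam.
have msum t : measurable ([set p : X * Y | t < l p + lstar p.2] : set (borel (X * Y)%type)).
  exact: (rect_union_coded_measurable mB (loss_sum_rect_lsc t)).
have mn := @borel_measurable_snd X Y.
pose lst : borel (X * Y)%type -> R := lstar \o snd.
have ilst : lam.-integrable setT (EFin \o lst).
  exact: (integrable_factor mn lam_nu lstar_int).
have Elst : (\int[lam]_p (lst p)%:E = \int[nu]_y (lstar y)%:E)%E.
  exact: (integral_factor mn lam_nu (measurable_int _ lstar_int)).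
have il : lam.-integrable setT (EFin \o (l : borel (X * Y)%type -> R)).
  apply: le_integrable (ilst) => //.
    by apply/measurable_EFinP; exact: measurable_loss.
  by move=> -[x1 y1] _ /=; rewrite lee_fin (le_trans (l_bounded _ _))// ler_norm.
split => //.
- exact: (joining_invariant mB bU UB m_ge0 mD m_nu cS BT m_inv lam_le lam_nu mT).
- pose V (j : nat) := [set p : X * Y | j.+1%:R^-1 < mdist theta (phi p.1)].
  have oV j : rect_union (coded_set B) (V j).
    rewrite (_ : V j = [set x | j.+1%:R^-1 < mdist theta (phi x)] `*` setT); last first.
      by apply/seteqP; split => p //= [].
    apply: rect_union_rect; last exact: coded_setT.
    rewrite (_ : [set x | _] = phi @^-1` [set t | j.+1%:R^-1 < mdist theta t])//.
    by apply: open_comp => [x _|]; [exact: cphi|exact: open_far].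
  have mV j : measurable (V j : set (borel (X * Y)%type)).
    exact: (rect_union_coded_measurable mB (oV j)).
  have V0 j : lam (V j) = 0%E.
    apply/eqP; rewrite -measure_le0; apply: (le_trans (lam_le _ (oV j))).
    rewrite lee_fin le_eqVlt; apply/orP; left; apply/eqP.
    apply: empiricalP; apply: cvg_near_cst.
    apply: filterS (small j.+1%:R^-1 _) => [i /= hi|]; last by rewrite invr_gt0.
    have [_ h _] := hnx i.
    rewrite /average /birkhoff_sum big1 ?mulr0// => k _.
    rewrite iter_prod_map indicE memNset//= => h'.
    have phik : phi (iter k S (nx i).2) = phi (nx i).2.
      by elim: k {h'} => //= k <-; exact: phiS.
    by move: h'; rewrite /V/= phik => h'; have := lt_trans (lt_trans h' h) hi; rewrite ltxx.
  have UV : [set p : X * Y | phi p.1 = theta] = ~` \bigcup_j V j.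
    apply/seteqP; split => p /=.
      by move=> pt [j _]; rewrite /V/= pt mdistxx ltNge invr_ge0 ler0n.
    move=> nV; apply: contrapT => pt; apply: nV.
    have d0 : 0 < mdist theta (phi p.1).
      by rewrite mdist_gt0; apply/eqP => h; apply: pt.
    exists (Num.truncn (mdist theta (phi p.1))^-1) => //; rewrite /V/=.
    by rewrite invf_plt ?posrE//; exact: truncnS_gt.
  have mUV : measurable (\bigcup_j V j : set (borel (X * Y)%type)).
    exact: bigcupT_measurable.
  rewrite UV probability_setC// (measure_negligible mUV) ?sube0//.
  by apply: negligible_bigcup => j; exists (V j); split; [exact: mV|exact: V0|].
- have le_half (b v u e : R) : v < e / 2 -> b + v + (u + e / 2) <= b + u + e by lra.
  have le_e e : 0 < e -> (\int[lam]_p (l p + lst p)%:E <=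
      (a + fine (\int[nu]_y (lstar y)%:E) + e)%:E)%E.
    move=> e0; apply: (@integral_le_empirical R _ _ lam tau F FU n z) => //.
    + by move=> -[x1 y1]; have := l_bounded x1 y1; rewrite ler_norml /lst/=; lra.
    + by move=> t; apply: lam_le; exact: loss_sum_rect_lsc.
    + have e2 : 0 < e / 2 by rewrite divr_gt0.
      have h1 := n_near _ (gen.2 _ e2); have h2 := small _ e2.
      apply: filterS2 h1 h2 => i /= h1 h2.
      rewrite averageD /z /lst average_snd.
      have [_ _ h3] := hnx i.
      apply: (le_trans (lerD h3 h1)); exact: le_half.
  have fin := integrable_fin_num measurableT lstar_int.
  rewrite /= in fin.
  have finl := integrable_fin_num measurableT il.
  have : (\int[lam]_p (l p + lst p)%:E <= (a + fine (\int[nu]_y (lstar y)%:E))%:E)%E.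
    by apply/lee_addgt0Pr => e /le_e; rewrite EFinD.
  under eq_integral do rewrite EFinD.
  rewrite integralD// Elst EFinD fineK//.
  by rewrite leeD2rE.
Qed.

End limit_joining.

(** * Joinings of a fiber and detection *)

Section fiber_transfer.
Context (R : realType) (X : ptopologicalType) (Y : ptopologicalType).
Context (Theta : pmetricType R) (nu : probability (borel Y) R).
Variables (S : X -> X) (T : Y -> Y) (l : X * Y -> R).
Variables (phi : X -> Theta) (phiS : phi \o S =1 phi).
Variables (U : nat -> set Y) (theta : Theta).
Hypothesis bU : countable_base U.
Hypothesis mT : measurable_fun setT (T : borel Y -> borel Y).
Hypothesis cphi : continuous phi.
Variable lstar : Y -> R.
Hypothesis cS : continuous S.
Hypothesis lstar_int : nu.-integrable setT (EFin \o (lstar : borel Y -> R)).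
Hypothesis l_bounded : forall x y, `|l (x, y)| <= lstar y.
Hypothesis ml : measurable_fun setT (l : borel (X * Y)%type -> R).
Local Notation Z := (fiber phi theta).

Lemma fiber_closed : closed Z.
Proof.
rewrite /fiber; apply: closed_comp => [x _|]; first exact: cphi.
by apply: accessible_closed_set1; apply: hausdorff_accessible; exact: metric_hausdorff.
Qed.

(** A measurable left inverse of the inclusion of the fiber in X, by which measures
    that sit over theta are pushed to the fiber. *)
Definition retract (z : Z) (x : X) : Z := insubd z x.

Lemma retract_id (z : Z) (x : X) : phi x = theta -> set_val (retract z x) = x.
Proof.
move=> px; rewrite /retract set_valE val_insubd; case: ifPn => //.
by rewrite notin_setE /fiber /=; case.
Qed.

Lemma retract_measurable (z : Z) :
  measurable_fun setT (retract z : borel X -> borel (pointed_at z)).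
Proof.
apply: generated_measurable => _ [V oV <-].
have mV : measurable (V : set (borel X)) by exact: sub_sigma_algebra.
have mZ : measurable (Z : set (borel X)).
  rewrite -[X in measurable X]setCK; apply: measurableC; apply: sub_sigma_algebra.
  exact: closed_openC fiber_closed.
rewrite (_ : _ @^-1` _ = (Z `&` V) `|` (~` Z `&` [set _ | V (set_val z)])).
  apply: measurableU; apply: measurableI => //; first exact: measurableC.
  have [Vz|nVz] := pselect (V (set_val z)).
    by rewrite (_ : [set _ | _] = setT)//; apply/seteqP; split.
  by rewrite (_ : [set _ | _] = set0)//; apply/seteqP; split.
apply/seteqP; split => x /=.
  have [Zx|nZx] := pselect (Z x); first by rewrite retract_id//; left.
  by rewrite set_valE val_insubd memNset//; right.
move=> [[Zx Vx]|[nZx Vz]]; first by rewrite retract_id.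
by rewrite set_valE val_insubd memNset.
Qed.

Lemma fiber_map_measurable (z : Z) : measurable_fun setT
  (@fiber_map _ _ _ _ phiS theta : borel (pointed_at z) -> borel (pointed_at z)).
Proof.
apply: generated_measurable => _ [V oV <-]; apply: sub_sigma_algebra.
exists (S @^-1` V); first by apply: open_comp => [x _|//]; exact: cS.
by apply/seteqP; split => x /=; rewrite !set_valE.
Qed.

Lemma fiber_val_measurable (z : Z) :
  measurable_fun setT (set_val : borel (pointed_at z) -> borel X).
Proof.
by apply: generated_measurable => V oV; apply: sub_sigma_algebra; exists V.
Qed.

Lemma fiber_prod_measurable (z : Z) : measurable_fun setT
  ((fun p => (@fiber_map _ _ _ _ phiS theta p.1, T p.2)) :
   borel (pointed_at z * Y)%type -> borel (pointed_at z * Y)%type).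
Proof.
exact: (@measurable_prod_map (pointed_at z) Y (pointed_at z) Y U
  (@fiber_map _ _ _ _ phiS theta) T bU (@fiber_map_measurable z) mT).
Qed.

Lemma fiber_loss_measurable (z : Z) : measurable_fun setT
  ((fun p => l (set_val (p.1 : Z), p.2)) : borel (pointed_at z * Y)%type -> R).
Proof.
apply: (measurableT_comp ml).
exact: (@measurable_prod_map (pointed_at z) Y X Y U set_val id bU
  (@fiber_val_measurable z) (@measurable_id _ _ _)).
Qed.

(** Over theta the retraction commutes with the dynamics and preserves the loss, and
    the rest of the space is a null set. *)
Lemma fiber_transfer (z : Z) (lambda : probability (borel (X * Y)%type) R) (a : R) :
  invariant_measure (prod_map S T : borel (X * Y)%type -> borel (X * Y)%type) lambda ->
  (forall A : set (borel Y), measurable A ->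
    lambda ((snd : borel (X * Y)%type -> borel Y) @^-1` A) = nu A) ->
  lambda [set p : X * Y | phi p.1 = theta] = 1%E ->
  (\int[lambda]_p (l p)%:E <= a%:E)%E ->
  (Lval T phiS l nu theta <= a%:E)%E.
Proof.
move=> inv lam_nu lam1 la.
pose Zz := pointed_at z.
pose r : borel (X * Y)%type -> borel (Zz * Y)%type := fun p => (retract z p.1 : Zz, p.2).
have mr : measurable_fun setT r.
  apply: (measurable_prod_map bU (S := retract z : X -> Zz) (T := id)).
    exact: retract_measurable.
  exact: measurable_id.
have [Q QE] := pushforward_probability lambda mr.
pose N := [set p : X * Y | phi p.1 = theta].
have mN : measurable (N : set (borel (X * Y)%type)).
  rewrite (_ : N = fst @^-1` Z)//.
  rewrite -[X in measurable X]setTI; apply: borel_measurable_fst => //.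
  rewrite -[X in measurable X]setCK; apply: measurableC; apply: sub_sigma_algebra.
  exact: closed_openC fiber_closed.
have NC0 : lambda (~` N) = 0%E by rewrite probability_setC// lam1 subee.
have lamN (A A' : set (borel (X * Y)%type)) : measurable A -> measurable A' ->
    (forall p, N p -> A p <-> A' p) -> lambda A = lambda A'.
  have cut (C : set (borel (X * Y)%type)) : measurable C -> lambda C = lambda (C `&` N).
    move=> mC; rewrite -[in LHS](setIT C) -(setUv N) setIUr measureU//.
    - rewrite [X in (_ + X)%E](_ : _ = 0%E) ?adde0//; apply/eqP.
      rewrite -measure_le0 -[leRHS]NC0; apply: le_measure; rewrite ?inE//.
        by apply: measurableI => //; exact: measurableC.
      exact: measurableC.
    - exact: measurableI.
    - by apply: measurableI => //; exact: measurableC.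
    - by rewrite setIACA setICr setI0.
  move=> mA mA' AA'; rewrite cut// (cut A')//; congr (lambda _).
  by apply/seteqP; split => p [h Np]; split => //; apply/(AA' p Np).
pose h : borel (Zz * Y)%type -> R := fun p => l (set_val (p.1 : Z), p.2).
have mh : measurable_fun setT h by exact: fiber_loss_measurable.
have ilst : lambda.-integrable setT (EFin \o ((lstar \o snd) : borel (X * Y)%type -> R)).
  exact: (integrable_factor (@borel_measurable_snd _ _) lam_nu lstar_int).
have mhr : measurable_fun setT (EFin \o (h \o r)).
  by apply/measurable_EFinP; exact: (measurableT_comp mh mr).
have ihr : lambda.-integrable setT ((EFin \o h) \o r).
  apply: le_integrable (ilst) => // -[x y] _.
  by rewrite /= lee_fin (le_trans (l_bounded _ _))// ler_norm.
have Eh : (\int[Q]_p (h p)%:E = \int[lambda]_p (l p)%:E)%E.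
  have Qr A : measurable A -> lambda (r @^-1` A) = Q A by move=> _; rewrite QE.
  have /measurable_EFinP mh' := mh.
  have /= <- := integral_factor mr Qr mh' ihr.
  apply: ae_eq_integral => //; first exact/measurable_EFinP.
  exists (~` N); split => //; first exact: measurableC.
  move=> [x y]; apply: contra_not => Np _ /=.
  by rewrite /h /r /= retract_id.
apply: ereal_inf_le.
exists (\int[Q]_p (h p)%:E)%E; last by rewrite Eh.
exists z, Q; split => //; split.
- move=> A mA; rewrite !QE -[RHS]inv; last first.
    by rewrite -[X in measurable X]setTI; exact: mr.
  apply: lamN.
  + rewrite -[X in measurable X]setTI; apply: mr => //.
    by rewrite -[X in measurable X]setTI; exact: fiber_prod_measurable.
  + rewrite -[X in measurable X]setTI.
    apply: (measurable_prod_map bU (continuous_borel cS) mT) => //.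
    by rewrite -[X in measurable X]setTI; exact: mr.
  + move=> [x y] Np; rewrite /r /prod_map /=.
    suff -> : fiber_map phiS (retract z x) = retract z (S x) by [].
    have pS : phi (S x) = theta by rewrite -[RHS]Np; exact: phiS.
    apply: val_inj; rewrite -!set_valE [RHS]retract_id//.
    by rewrite -[in RHS](retract_id z (Np : phi x = theta)) set_valE.
- by move=> A mA; rewrite QE -lam_nu.
Qed.

End fiber_transfer.

Section detection.
Context (R : realType) (X : pmetricType R) (Y : pmetricType R).
Context (Theta : pmetricType R) (nu : probability (borel Y) R).
Variables (S : X -> X) (T : Y -> Y) (l : X * Y -> R) (lstar : Y -> R).
Variables (phi : X -> Theta) (phiS : phi \o S =1 phi).
Hypothesis sepY : separable Y.
Hypothesis mT : measurable_fun setT (T : borel Y -> borel Y).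
Hypothesis Tinv : invariant_measure (T : borel Y -> borel Y) nu.
Hypothesis Terg : ergodic (T : borel Y -> borel Y) nu.
Hypothesis cX : compact [set: X].
Hypothesis cS : continuous S.
Hypothesis l_lsc : forall t : R, open [set p | t < l p].
Hypothesis lstar_int : nu.-integrable setT (EFin \o (lstar : borel Y -> R)).
Hypothesis l_bounded : forall x y, `|l (x, y)| <= lstar y.
Hypothesis cphi : continuous phi.

Lemma fiber_from_orbits (theta : Theta) :
  (forall e : R, 0 < e -> exists x, mdist theta (phi x) < e) ->
  exists x, phi x = theta.
Proof.
move=> h; have /choice[x hx] : forall i : nat, exists x, mdist theta (phi x) < i.+1%:R^-1.
  by move=> i; apply: h; rewrite invr_gt0.
have [p [_ clp]] := @cX (x @ \oo) _ filterT.
exists p; apply: esym; apply: mdist_positivity; apply/eqP.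
rewrite eq_le mdist_ge0 andbT leNgt; apply/negP => d0.
pose d : R := mdist theta (phi p); have d2 : 0 < d / 2 by rewrite divr_gt0.
have [||q [xq pq]] := clp [set q | mdist theta (phi q) < d / 2]
   (phi @^-1` ball (phi p) (d / 2)).
- exists (Num.truncn (d / 2)^-1) => // i /= di.
  apply: (lt_le_trans (hx i)); rewrite invf_ple ?posrE//.
  by apply: (le_trans (ltW (truncnS_gt _))); rewrite ler_nat ltnS.
- by apply: cphi; exact: nbhsx_ballx.
move: pq; rewrite /= ballEmdist/= => pq.
have := metric_triangle theta (phi q) (phi p); rewrite -/d (metric_sym (phi q)).
by move: xq pq => /=; lra.
Qed.

(** Genericity of y is a condition stated before theta, a and the starting points
    are chosen; so one null set serves them all. *)
Lemma ae_Lval_le : {ae nu, forall y, forall (theta : Theta) (a : R),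
  (forall (N : nat) (e : R), 0 < e -> exists n x,
    [/\ (N <= n)%N, mdist theta (phi x) < e &
        average (prod_map S T) l n (x, y) <= a + e]) ->
  (Lval T phiS l nu theta <= a%:E)%E}.
Proof.
(* The superlevel sets of lstar are coded too, so that those of l + lstar
   are unions of rectangles. *)
have [U bU] := separable_base sepY.
have mlst : measurable_fun setT (lstar : borel Y -> R).
  by apply/measurable_EFinP; exact: measurable_int lstar_int.
have [B [mB UB lB BT]] := coding_family bU mT mlst.
apply: ae_imply (ae_generic_point mB mT Tinv Terg lstar_int) => y gen theta a orb.
have [lam [inv lam_nu lam1 la]] := limit_joining bU mB UB lB BT cX cS mT l_lsc
  lstar_int l_bounded cphi phiS gen orb.
have [x px] : exists x, phi x = theta.
  by apply: fiber_from_orbits => e e0; have [n [x [_ h _]]] := orb 0%N e e0; exists x.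
have zx : x \in fiber phi theta by apply/mem_set.
exact: (fiber_transfer phiS bU mT cphi cS lstar_int l_bounded (measurable_loss l_lsc)
  (SigSub zx) inv lam_nu lam1 la).
Qed.

End detection.

(** * Approximation of a joining by orbits in its fiber *)

Section upper.
Context (R : realType) (X : pmetricType R) (Y : pmetricType R).
Context (Theta : pmetricType R) (nu : probability (borel Y) R).
Variables (S : X -> X) (T : Y -> Y) (l : X * Y -> R) (lstar : Y -> R).
Variables (phi : X -> Theta) (phiS : phi \o S =1 phi).
Hypothesis sepY : separable Y.
Hypothesis mT : measurable_fun setT (T : borel Y -> borel Y).
Hypothesis Tinv : invariant_measure (T : borel Y -> borel Y) nu.
Hypothesis Terg : ergodic (T : borel Y -> borel Y) nu.
Hypothesis cX : compact [set: X].
Hypothesis cS : continuous S.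
Hypothesis l_lsc : forall t : R, open [set p | t < l p].
Hypothesis lstar_int : nu.-integrable setT (EFin \o (lstar : borel Y -> R)).
Hypothesis l_bounded : forall x y, `|l (x, y)| <= lstar y.
Hypothesis cphi : continuous phi.

(** [ergodic_upper] is applied to a joining whose integral is below c, with P n t the
    set of the y such that the n-th loss sum exceeds t at every point of the fiber.
    The fiber is stable under S, so prefixing an observation lowers the least loss
    sum by at most lstar. *)
Lemma ae_fiber_upper (theta : Theta) (c : R) : (Lval T phiS l nu theta < c%:E)%E ->
  {ae nu, forall y, forall e, 0 < e -> \forall n \near \oo,
    exists x, phi x = theta /\ average (prod_map S T) l n (x, y) <= c + e}.
Proof.
move=> /ereal_inf_lt[_ [z [lam [[inv lam_nu] ->]]] lc].
have [U bU] := separable_base sepY.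
pose E := borel (pointed_at z * Y)%type.
pose tauZ : E -> E := fun p => (@fiber_map _ _ _ _ phiS theta p.1, T p.2).
pose h : E -> R := fun p => l (set_val (p.1 : fiber phi theta), p.2).
have ml : measurable_fun setT (l : borel (X * Y)%type -> R) by exact: measurable_loss.
have mtauZ : measurable_fun setT tauZ.
  exact: (fiber_prod_measurable phiS bU mT cS (z := z)).
have mh : measurable_fun setT h by exact: (fiber_loss_measurable bU ml (z := z)).
have mpi : measurable_fun setT (snd : E -> borel Y) by exact: borel_measurable_snd.
have ilst : lam.-integrable setT (EFin \o ((lstar \o snd) : E -> R)).
  exact: (integrable_factor mpi lam_nu lstar_int).
have ih : lam.-integrable setT (EFin \o h).
  apply: le_integrable (ilst) => //; first exact/measurable_EFinP.
  move=> [x y] _.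
  by rewrite /= lee_fin (le_trans (l_bounded _ _))// ler_norm.
pose P n t : set (borel Y) :=
  [set y | forall x, phi x = theta -> t < birkhoff_sum (prod_map S T) l n (x, y)].
have mP n t : measurable (P n t).
  apply: (@measurable_forall_compact X _ (borel Y) (fiber phi theta)
    [set p | t < birkhoff_sum (prod_map S T) l n p]).
    by apply: subclosed_compact cX _ => //; exact: fiber_closed.
  apply: rect_lsc_birkhoff => //.
  - by move=> A A'; exact: measurableI.
  - by move=> A mA; rewrite -[X in measurable X]setTI; exact: mT.
  - move=> s; apply: (@rect_union_open X Y _ U) => //.
    by move=> j; apply: sub_sigma_algebra; exact: bU.1.
have Pmono n t t' y : t' <= t -> P n t y -> P n t' y.
  by move=> tt' Py x px; apply: le_lt_trans tt' (Py x px).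
have PS n t y : P n t (T y) -> P n.+1 (t - lstar y) y.
  move=> Py x px; rewrite birkhoff_sumS.
  have /Py : phi (S x) = theta by rewrite -px; exact: phiS.
  rewrite /prod_map/=; have := l_bounded x y; rewrite ler_norml => /andP[+ _].
  by set u := birkhoff_sum _ _ _ _; lra.
have iterE k (e : E) : ((set_val (iter k tauZ e).1, (iter k tauZ e).2) : X * Y) =
    iter k (prod_map S T) (set_val (e.1 : fiber phi theta), e.2).
  by elim: k => //= k <-.
have Pg n t e : P n t (snd e) -> t < birkhoff_sum tauZ h n e.
  move=> /(_ (set_val (e.1 : fiber phi theta))) Pe.
  have -> : birkhoff_sum tauZ h n e =
      birkhoff_sum (prod_map S T) l n (set_val (e.1 : fiber phi theta), e.2).
    by apply: eq_big_nat => k _; rewrite -iterE.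
  by apply: Pe; exact: (set_valP (e.1 : fiber phi theta)).
apply: ae_imply (ergodic_upper mT Tinv Terg mtauZ inv mpi lam_nu ih lc mP Pmono PS Pg).
move=> y [M hM] e e0.
exists (Num.truncn (M%:R / e)) => // n /= Mn.
have /existsNP[x /not_implyP[px /negP]] := hM n.+1.
rewrite -leNgt => le; exists x; split => //.
rewrite /average mulrC ler_pdivrMr//; apply: (le_trans le).
rewrite mulrC mulrDl lerD2l mulrC -ler_pdivrMr//.
by apply: (le_trans (ltW (truncnS_gt _))); rewrite ler_nat ltnS.
Qed.

End upper.

(** * Minimizing parameters and estimation schemes *)

Section minimizers.
Context (R : realType) (X : pmetricType R) (Y : pmetricType R).
Context (Theta : pmetricType R) (nu : probability (borel Y) R).
Variables (S : X -> X) (T : Y -> Y) (l : X * Y -> R) (lstar : Y -> R).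
Variables (phi : X -> Theta) (phiS : phi \o S =1 phi).
Hypothesis sepY : separable Y.
Hypothesis mT : measurable_fun setT (T : borel Y -> borel Y).
Hypothesis Tinv : invariant_measure (T : borel Y -> borel Y) nu.
Hypothesis Terg : ergodic (T : borel Y -> borel Y) nu.
Hypothesis cX : compact [set: X].
Hypothesis cS : continuous S.
Hypothesis l_lsc : forall t : R, open [set p | t < l p].
Hypothesis lstar_int : nu.-integrable setT (EFin \o (lstar : borel Y -> R)).
Hypothesis l_bounded : forall x y, `|l (x, y)| <= lstar y.
Hypothesis cTheta : compact [set: Theta].
Hypothesis cphi : continuous phi.

Let L := Lval T phiS l nu.
Let avg n x y := average (prod_map S T) l n (x, y).
Let Istar := fine (\int[nu]_y (lstar y)%:E).

(** The almost sure conclusion of [ae_Lval_le] at a point y. *)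
Let detects_joinings (y : Y) := forall (theta : Theta) (a : R),
  (forall (N : nat) (e : R), 0 < e -> exists n x,
    [/\ (N <= n)%N, mdist theta (phi x) < e & avg n x y <= a + e]) ->
  (L theta <= a%:E)%E.

Let ae_detects : {ae nu, forall y, detects_joinings y}.
Proof.
exact: (ae_Lval_le phiS sepY mT Tinv Terg cX cS l_lsc lstar_int l_bounded cphi).
Qed.

Let ae_lstar : {ae nu, forall y, forall e, 0 < e ->
  \forall n \near \oo, average T lstar n y <= Istar + e}.
Proof. exact: (@birkhoff_limsup R _ (borel Y)). Qed.

Let avg_le n x y : avg n x y <= average T lstar n y.
Proof.
rewrite -(average_snd S T lstar n x y); apply: average_le => -[x' y'] /=.
by rewrite (le_trans (ler_norm _)).
Qed.

Let avg_ge n x y : - average T lstar n y <= avg n x y.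
Proof.
rewrite -(average_snd S T lstar n x y) -mulN1r -averageZ; apply: average_le => -[x' y'] /=.
by rewrite mulN1r; have := l_bounded x' y'; rewrite ler_norml => /andP[].
Qed.

Let ae_upper (theta : Theta) (a : R) : (L theta <= a%:E)%E ->
  {ae nu, forall y, forall e, 0 < e -> \forall n \near \oo,
    exists x, phi x = theta /\ avg n x y <= a + e}.
Proof.
move=> La.
have h (k : nat) : {ae nu, forall y, forall e, 0 < e -> \forall n \near \oo,
    exists x, phi x = theta /\ avg n x y <= (a + k.+1%:R^-1) + e}.
  have La' : (L theta < (a + k.+1%:R^-1)%:E)%E.
    by apply: le_lt_trans La _; rewrite lte_fin ltrDl invr_gt0.
  exact: (ae_fiber_upper sepY mT Tinv Terg cX cS l_lsc lstar_int l_bounded cphi La').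
apply: ae_imply (ae_forall_countable h) => y hy e e0.
have e2 : 0 < e / 2 by rewrite divr_gt0.
have [k hk] := harmonic_lt e2.
have [N _ hN] := hy k _ e2; exists N => // n /hN[x [px ax]]; exists x; split => //.
apply: (le_trans ax); have := hk k (leqnn k); set u := _^-1; lra.
Qed.

(** The averages of l lie above those of - lstar, whereas approximation would produce
    points with smaller averages. *)
Lemma Lval_ge theta : ((- Istar)%:E <= L theta)%E.
Proof.
rewrite leNgt; apply/negP => LI.
have [c Lc cI] : exists2 c : R, (L theta <= c%:E)%E & c < - Istar.
  case: (L theta) LI => [r| |]//.
    by rewrite lte_fin => rI; exists r.
  by move=> _; exists (- Istar - 1); [rewrite leNye|lra].
have [y [uy ly]] := ae_exists (ae_and (ae_upper Lc) ae_lstar).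
pose e := (- Istar - c) / 4; have e0 : 0 < e by rewrite /e; lra.
have [n [[x [_ h1]] h2]] : exists n,
    (exists x, phi x = theta /\ avg n x y <= c + e) /\ average T lstar n y <= Istar + e.
  have [n1 _ h1] := uy e e0; have [n2 _ h2] := ly e e0.
  exists (maxn n1 n2); split; [apply: h1|apply: h2]; rewrite /= ?leq_maxl//.
  exact: leq_maxr.
have h3 := avg_ge n x y; move: h1 h2 h3; rewrite /e.
by set u := avg _ _ _; set v := average _ _ _ _; lra.
Qed.

Lemma Lval_point : (L (phi point) <= Istar%:E)%E.
Proof.
have [y [ky ly]] := ae_exists (ae_and ae_detects ae_lstar).
apply: ky => N e e0; have [M _ hM] := ly _ e0.
exists (maxn N M), point; split; first exact: leq_maxl.
  by rewrite mdistxx.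
by apply: (le_trans (avg_le _ _ _)); apply: hM; rewrite /= leq_maxr.
Qed.

(** By approximation there are almost optimal points in the fibers over theta', and
    by detection they bound L at theta. *)
Lemma Lval_lsc theta (a : R) :
  (forall e : R, 0 < e -> exists theta', mdist theta theta' < e /\
    (L theta' <= (a + e)%:E)%E) ->
  (L theta <= a%:E)%E.
Proof.
move=> h.
have /choice[th hth] : forall i : nat, exists theta', mdist theta theta' < i.+1%:R^-1 /\
    (L theta' <= (a + i.+1%:R^-1)%:E)%E.
  by move=> i; apply: h; rewrite invr_gt0.
have up i := ae_upper (hth i).2.
have [y [ky hy]] := ae_exists (ae_and ae_detects (ae_forall_countable up)).
apply: ky => N e e0.
have e2 : 0 < e / 2 by rewrite divr_gt0.
have [k hk] := harmonic_lt e2; have {}hk := hk k (leqnn k).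
have [M _ hM] := hy k _ e2.
have /hM[x [px ax]] : (M <= maxn N M)%N by exact: leq_maxr.
exists (maxn N M), x; split; first exact: leq_maxl.
  by rewrite px; apply: lt_trans (hth k).1 _; move: hk; set u := _^-1; lra.
by apply: (le_trans ax); move: hk; set u := _^-1; lra.
Qed.

(** Detection applies at every cluster point of the parameters of the starting
    points, and there is one since Theta is compact. *)
Lemma orbits_cluster y (Q : X -> Prop) (a : R) : detects_joinings y ->
  (forall N : nat, exists n x, [/\ (N <= n)%N, Q x & avg n x y <= a + N.+1%:R^-1]) ->
  exists theta, (L theta <= a%:E)%E /\
    forall e : R, 0 < e -> exists x, Q x /\ mdist theta (phi x) < e.
Proof.
move=> ky h.
have /choice[nx hnx] : forall N : nat, exists nx : nat * X,
    [/\ (N <= nx.1)%N, Q nx.2 & avg nx.1 nx.2 y <= a + N.+1%:R^-1].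
  by move=> N; have [n [x ?]] := h N; exists (n, x).
pose t i := phi (nx i).2.
have [theta [_ clt]] := @cTheta (t @ \oo) _ filterT.
have near_t N e : 0 < e -> exists i, (N <= i)%N /\ mdist theta (t i) < e.
  move=> e0.
  have [||s [[i Ni <-] ti]] := clt (t @` [set i | (N <= i)%N]) (ball theta e).
  - by exists N => // i /= Ni; exists i.
  - exact: nbhsx_ballx.
  by exists i; split => //; move: ti; rewrite ballEmdist.
exists theta; split; last first.
  move=> e e0; have [i [_ ti]] := near_t 0%N e e0.
  by exists (nx i).2; split => //; have [] := hnx i.
apply: ky => N e e0; have [k hk] := harmonic_lt e0.
have [i [Ni ti]] := near_t (maxn N k) e e0.
have [ni _ ai] := hnx i.
exists (nx i).1, (nx i).2; split => //.
  by apply: leq_trans ni; apply: leq_trans Ni; exact: leq_maxl.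
apply: (le_trans ai); rewrite lerD2l ltW//; apply: hk.
by apply: leq_trans Ni; exact: leq_maxr.
Qed.

Lemma Lval_min : exists m : R, (forall theta, m%:E <= L theta)%E /\
  exists theta, (L theta <= m%:E)%E.
Proof.
pose A := [set a : R | exists theta, (L theta <= a%:E)%E].
have A0 : A !=set0 by exists Istar, (phi point); exact: Lval_point.
have lbA : lbound A (- Istar).
  move=> a [theta La]; rewrite -lee_fin; exact: le_trans (Lval_ge theta) La.
have infA : has_inf A by split => //; exists (- Istar).
exists (inf A); split.
  move=> theta; rewrite leNgt; apply/negP => lt.
  have : (-oo < L theta)%E by apply: lt_le_trans (Lval_ge theta); rewrite ltNyr.
  case E : (L theta) lt => [r| |]// lt _.
  have : A r by exists theta; rewrite E.
  move=> /(ge_inf (ex_intro _ _ lbA)); rewrite leNgt; move: lt.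
  by rewrite lte_fin => ->.
have /choice[th hth] : forall i : nat, exists theta, (L theta <= (inf A + i.+1%:R^-1)%:E)%E.
  move=> i; have i0 : 0 < i.+1%:R^-1 :> R by rewrite invr_gt0.
  have [a [theta La] ai] := inf_adherent i0 infA.
  by exists theta; apply: (le_trans La); rewrite lee_fin ltW.
have [theta [_ clt]] := @cTheta (th @ \oo) _ filterT.
exists theta; apply: Lval_lsc => e e0.
have [k hk] := harmonic_lt e0.
have [||s [[i ki <-] ti]] := clt (th @` [set i | (k <= i)%N]) (ball theta e).
- by exists k => // i /= ki; exists i.
- exact: nbhsx_ballx.
exists (th i); split; first by move: ti; rewrite ballEmdist.
by apply: (le_trans (hth i)); rewrite lee_fin lerD2l ltW// hk.
Qed.

Let Tmin := Theta_min T phiS l nu.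

Section with_min.
Variable m : R.
Hypothesis Lm : (forall theta, m%:E <= L theta)%E.
Hypothesis mL : exists theta, (L theta <= m%:E)%E.

Lemma Theta_minP theta : Tmin theta <-> (L theta <= m%:E)%E.
Proof.
split => [h|h theta']; last exact: le_trans h (Lm theta').
by have [theta' h'] := mL; apply: le_trans h'; exact: h.
Qed.

Lemma Theta_min_compact : compact Tmin.
Proof.
apply: (subclosed_compact _ cTheta) => //.
move=> theta clt; apply/Theta_minP; apply: Lval_lsc => e e0.
have [s [/Theta_minP Ls ts]] := clt _ (nbhsx_ballx theta e e0).
exists s; split; first by move: ts; rewrite ballEmdist.
by apply: (le_trans Ls); rewrite lee_fin lerDl ltW.
Qed.

Lemma avg_eventually_ge y : detects_joinings y -> forall e, 0 < e ->
  \forall n \near \oo, forall x, m - e <= avg n x y.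
Proof.
move=> ky e e0; apply: contrapT => nh.
have [N|theta [Lt _]] := @orbits_cluster y setT (m - e) ky; last first.
  by have := le_trans (Lm theta) Lt; rewrite lee_fin; lra.
have /existsNP[n /not_implyP[Nn /existsNP[x /negP]]] :
    ~ (forall n, (N <= n)%N -> forall x, m - e <= avg n x y).
  by move=> h; apply: nh; exists N.
rewrite -ltNge => lt; exists n, x; split => //.
by apply: ltW; apply: lt_trans lt _; rewrite ltrDl invr_gt0.
Qed.

Let v n y := inf [set avg_loss S T l n x' y | x' in [set: X]].

Lemma has_lbound_avg n y : has_lbound [set avg_loss S T l n x' y | x' in [set: X]].
Proof.
by exists (- average T lstar n y) => _ [x _ <-]; rewrite avg_lossE; exact: avg_ge.
Qed.

(** The lower bound is detection over all of Theta; the upper bound is approximation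
    in one optimal fiber. *)
Lemma inf_avg_cvg : {ae nu, forall y, v n y @[n --> \oo] --> m}.
Proof.
have [theta0 L0] := mL.
apply: ae_imply (ae_and ae_detects (ae_upper L0)) => y [ky uy].
apply/cvgrPdist_le => e e0.
have [n1 _ h1] := avg_eventually_ge ky e0; have [n2 _ h2] := uy e e0.
exists (maxn n1 n2) => // n /=; rewrite geq_max => /andP[nn1 nn2].
have [x [_ ax]] := h2 n nn2.
have le1 : v n y <= m + e.
  apply: le_trans ax; apply: ge_inf; first exact: has_lbound_avg.
  by exists x => //; rewrite avg_lossE.
have le2 : m - e <= v n y.
  apply: lb_le_inf; first by exists (avg_loss S T l n point y), point.
  by move=> _ [x' _ <-]; rewrite avg_lossE; exact: h1.
rewrite ler_norml; apply/andP; split; lra.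
Qed.

(** If the distance to Theta_min exceeded e infinitely often, the corresponding
    parameters would have a cluster point at distance at least e from Theta_min,
    at which detection gives L <= m. *)
Lemma scheme_converges (th : forall n, n.+1.-tuple Y -> Theta) :
  optimal_scheme S T nu l phi th ->
  {ae nu, forall y,
    dist_to_set (th n (orbit_tuple T n y)) Tmin @[n --> \oo] --> 0}.
Proof.
move=> [_ [x [thx opt]]].
apply: ae_imply (ae_and ae_detects (ae_and inf_avg_cvg opt)) => y [ky [vm [cu cv uv]]].
pose u n := avg_loss S T l n (x n (orbit_tuple T n y)) y.
have um : u n @[n --> \oo] --> m.
  by move: cu; rewrite uv; rewrite (cvg_lim _ vm).
apply/cvgrPdist_lt => e e0; apply: contrapT => nh.
pose Q z := e <= dist_to_set (phi z) Tmin.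
have dist_ge0 t : 0 <= dist_to_set t Tmin.
  have [theta0 L0] := mL.
  apply: lb_le_inf; first by exists (mdist t theta0), theta0 => //; exact/Theta_minP.
  by move=> _ [s _ <-]; exact: mdist_ge0.
have [N|theta [Lt near_t]] := @orbits_cluster y Q m ky.
  have N0 : 0 < N.+1%:R^-1 :> R by rewrite invr_gt0.
  have /cvgrPdist_le/(_ _ N0)[M _ hM] := um.
  have /existsNP[n /not_implyP[nMN /negP]] : ~ (forall n, (maxn N M <= n)%N ->
      `|0 - dist_to_set (th n (orbit_tuple T n y)) Tmin| < e).
    by move=> h; apply: nh; exists (maxn N M).
  rewrite -leNgt sub0r normrN ger0_norm// => ed.
  move: nMN; rewrite geq_max => /andP[Nn Mn].
  exists n, (x n (orbit_tuple T n y)); split => //.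
    by rewrite /Q; move: ed; rewrite thx.
  have := hM n Mn; rewrite /u avg_lossE ler_norml => /andP[+ _].
  by rewrite /avg; set a := average _ _ _ _; set b := _^-1; lra.
have [z [Qz tz]] := near_t e e0.
have : dist_to_set (phi z) Tmin <= mdist theta (phi z).
  apply: ge_inf; first by exists 0 => _ [s _ <-]; exact: mdist_ge0.
  by exists theta; [exact/Theta_minP|exact: metric_sym].
by move: Qz tz; rewrite /Q; lra.
Qed.

(** The estimates are constantly theta0: the points x n minimize, up to 1/(n+1), the
    loss of the data within the fiber over theta0, and approximation makes them
    asymptotically optimal in the whole of X. *)
Lemma scheme_exists (theta0 : Theta) : Tmin theta0 ->
  exists th : forall n, n.+1.-tuple Y -> Theta,
    optimal_scheme S T nu l phi th /\
    {ae nu, forall y, th n (orbit_tuple T n y) @[n --> \oo] --> theta0}.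
Proof.
move=> /Theta_minP L0.
pose loss n (t : n.+1.-tuple Y) (x : X) :=
  n.+1%:R^-1 * \sum_(k < n.+1) l (iter k S x, tnth t k).
have lossE n x y : loss n (orbit_tuple T n y) x = avg n x y.
  rewrite /avg -avg_lossE /avg_loss big_mkord; congr (_ * _).
  by apply: eq_bigr => k _; rewrite tnth_mktuple.
have [y0 uy0] := ae_exists (ae_upper L0).
have [x0 px0] : exists x0, phi x0 = theta0.
  by have [N _ /(_ N (leqnn N))[x [px _]]] := uy0 1 ltr01; exists x.
have near_opt n (t : n.+1.-tuple Y) : exists x, phi x = theta0 /\
    forall x', phi x' = theta0 -> loss n t x <= loss n t x' + n.+1%:R^-1.
  pose A := [set loss n t x | x in [set x | phi x = theta0]].
  have lbA : has_lbound A.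
    exists (n.+1%:R^-1 * \sum_(k < n.+1) - lstar (tnth t k)) => _ [x _ <-].
    rewrite /loss ler_pM2l ?invr_gt0//; apply: ler_sum => k _.
    by have := l_bounded (iter k S x) (tnth t k); rewrite ler_norml => /andP[].
  have n0 : 0 < n.+1%:R^-1 :> R by rewrite invr_gt0.
  have infA : has_inf A by split => //; exists (loss n t x0), x0.
  have [_ [x px <-] ltx] := inf_adherent n0 infA.
  exists x; split => // x' px'; apply: (le_trans (ltW ltx)).
  by rewrite lerD2r; apply: ge_inf => //; exists x'.
pose x n t := projT1 (cid (near_opt n t)).
have hx n t : phi (x n t) = theta0 /\
    forall x', phi x' = theta0 -> loss n t (x n t) <= loss n t x' + n.+1%:R^-1.
  exact: (projT2 (cid (near_opt n t))).
exists (fun n t => theta0); split; last by apply: aeW => y; exact: cvg_cst.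
split; first by move=> n; exact: measurable_cst.
exists x; split.
  by move=> n; apply/funext => t; rewrite /= (hx n t).1.
apply: ae_imply (ae_and ae_detects (ae_and inf_avg_cvg (ae_upper L0))) => y [ky [vm uy]].
set u := fun n => _.
have um : u n @[n --> \oo] --> m.
  apply/cvgrPdist_le => e e0.
  have e2 : 0 < e / 2 by rewrite divr_gt0.
  have [n1 _ h1] := avg_eventually_ge ky e0; have [n2 _ h2] := uy _ e2.
  have [n3 h3] := harmonic_lt e2.
  exists (maxn n1 (maxn n2 n3)) => // n /=; rewrite !geq_max => /and3P[nn1 nn2 nn3].
  have [x' [px' ax']] := h2 n nn2.
  have := (hx n (orbit_tuple T n y)).2 x' px'; rewrite !lossE.
  have := h1 n nn1 (x n (orbit_tuple T n y)); have := h3 n nn3; move: ax'.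
  rewrite /u avg_lossE -/(avg _ _ _); set a := avg n x' y; set b := avg _ _ _.
  set w : R := _^-1; move=> g1 g2 g3 g4.
  rewrite ler_norml; apply/andP; split; lra.
split; [by apply/cvg_ex; exists m|by apply/cvg_ex; exists m|].
by rewrite (cvg_lim _ um)//; rewrite (cvg_lim _ vm).
Qed.

End with_min.
End minimizers.

Theorem theorem3p2 (R : realType)
    (Y : completePMetricType R) (T : Y -> Y) (nu : probability (borel Y) R)
    (X : pmetricType R) (S : X -> X)
    (l : X * Y -> R) (lstar : Y -> R)
    (Theta : pmetricType R) (phi : X -> Theta)
    (Y_separable : separable Y)
    (T_measurable : measurable_fun [set: borel Y] (T : borel Y -> borel Y))
    (nu_invariant : invariant_measure (T : borel Y -> borel Y) nu)
    (nu_ergodic : ergodic (T : borel Y -> borel Y) nu)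
    (X_compact : compact [set: X])
    (S_continuous : continuous S)
    (l_lsc : lower_semicontinuous (fun p : X * Y => (l p)%:E))
    (lstar_integrable : nu.-integrable setT (EFin \o (lstar : borel Y -> R)))
    (l_bounded : forall x y, `|l (x, y)| <= lstar y)
    (Theta_compact : compact [set: Theta])
    (phi_continuous : continuous phi)
    (phiS : phi \o S =1 phi) :
  let Tmin := Theta_min T phiS l nu in
  [/\ Tmin !=set0 /\ compact Tmin,
      forall th : forall n, n.+1.-tuple Y -> Theta,
        optimal_scheme S T nu l phi th ->
        {ae nu, forall y,
          dist_to_set (th n (orbit_tuple T n y)) Tmin @[n --> \oo] --> 0} &
      forall theta0, Tmin theta0 ->
        exists th : forall n, n.+1.-tuple Y -> Theta,
          optimal_scheme S T nu l phi th /\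
          {ae nu, forall y,
            th n (orbit_tuple T n y) @[n --> \oo] --> theta0}].
Proof.
move=> Tmin.
have l_open (t : R) : open [set p : X * Y | t < l p].
  by have /lower_semicontinuousP/(_ t) := l_lsc.
have [m [Lm mL]] := Lval_min phiS Y_separable T_measurable nu_invariant nu_ergodic
  X_compact S_continuous l_open lstar_integrable l_bounded Theta_compact phi_continuous.
split.
- split.
    by have [theta Lt] := mL; exists theta; exact/(Theta_minP Lm mL).
  exact: (Theta_min_compact Y_separable T_measurable nu_invariant nu_ergodic
    X_compact S_continuous l_open lstar_integrable l_bounded Theta_compact phi_continuous Lm mL).
- move=> th opt.
  exact: (scheme_converges Y_separable T_measurable nu_invariant nu_ergodic
    X_compact S_continuous l_open lstar_integrable l_bounded Theta_compact phi_continuous Lm mL opt).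
- move=> theta0 Tt.
  exact: (scheme_exists Y_separable T_measurable nu_invariant nu_ergodic
    X_compact S_continuous l_open lstar_integrable l_bounded Theta_compact phi_continuous Lm mL Tt).
Qed.
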